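(* Let $\alpha,\beta,\gamma>-1$. For $f\in L^2([-1,1]^2,\varpi_{\alpha,\gamma},\varpi_{\beta,\gamma})$, $m\ge1$ and $(x,y)$ on the boundary of $[-1,1]^2$, $$\begin{aligned}S_{2m}f(x,y)={}&S_m^{\alpha,\beta,\gamma}(G_{0,0}\circ\psi)(x^2,y^2)+y\,S_{m-1}^{\alpha,\beta+1,\gamma}(G_{0,1}\circ\psi)(x^2,y^2)\\&+x\,S_{m-1}^{\alpha+1,\beta,\gamma}(G_{1,0}\circ\psi)(x^2,y^2)+xy\,S_{m-1}^{\alpha+1,\beta+1,\gamma}(G_{1,1}\circ\psi)(x^2,y^2),\end{aligned}$$ $$\begin{aligned}S_{2m+1}f(x,y)={}&S_m^{\alpha,\beta,\gamma}(G_{0,0}\circ\psi)(x^2,y^2)+y\,S_m^{\alpha,\beta+1,\gamma}(G_{0,1}\circ\psi)(x^2,y^2)\\&+x\,S_m^{\alpha+1,\beta,\gamma}(G_{1,0}\circ\psi)(x^2,y^2)+xy\,S_{m-1}^{\alpha+1,\beta+1,\gamma}(G_{1,1}\circ\psi)(x^2,y^2).\end{aligned}$$ In particular, there is a constant $c$ depending only on $\alpha,\beta,\gamma$ such that for all such $f$ and all $n\ge2$ $$\|S_nf-f\|_{L^2(\varpi_{\alpha,\gamma},\varpi_{\beta,\gamma})}\le c\sum_{\delta_1,\delta_2\in\{0,1\}}\left\|S_{k}^{\alpha+\delta_1,\beta+\delta_2,\gamma}(G_{\delta_1,\delta_2}\circ\psi)-G_{\delta_1,\delta_2}\circ\psi\right\|_{\alpha+\delta_1,\beta+\delta_2,\gamma},$$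 where $k=k(n,\delta_1,\delta_2)=\lfloor (n-\delta_1-\delta_2)/2\rfloor$ is the index occurring in the formulas above; and each summand is in turn bounded as follows: writing $H=G_{\delta_1,\delta_2}\circ\psi$, $a=\alpha+\delta_1$, $b=\beta+\delta_2$, $H_1(x)=H(x,1)$, $H_2(x)=H(1,x)$, $g_i(x)=\frac{H_i(x)-H(1,1)}{1-x}$, $$\begin{aligned}\|S_k^{a,b,\gamma}H-H\|_{a,b,\gamma}\le c\big(&\|H_1-s_k^{a,\gamma}H_1\|_{L^2(w_{a,\gamma})}+\|H_2-s_k^{b,\gamma}H_2\|_{L^2(w_{b,\gamma})}\\&+\|g_1-s_k^{a,\gamma+2}g_1\|_{L^2(w_{a,\gamma+2})}+\|g_2-s_k^{b,\gamma+2}g_2\|_{L^2(w_{b,\gamma+2})}\big).\end{aligned}$$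
   Context: For $\alpha,\gamma>-1$ let $w_{\alpha,\gamma}(x)=x^\alpha(1-x)^\gamma$ on $[0,1]$, $c_{\alpha,\gamma}=\left(\int_0^1w_{\alpha,\gamma}\right)^{-1}$, $\varpi_{\alpha,\gamma}(x)=|x|^{2\alpha+1}(1-x^2)^\gamma$ on $[-1,1]$; $\|g\|_{L^2(v)}^2=\int_0^1|g|^2v\,dx$. Boundary of the square: $$\langle f,g\rangle=c_{\alpha,\gamma}\int_{-1}^1[f(x,-1)g(x,-1)+f(x,1)g(x,1)]\varpi_{\alpha,\gamma}(x)\,dx+c_{\beta,\gamma}\int_{-1}^1[f(-1,y)g(-1,y)+f(1,y)g(1,y)]\varpi_{\beta,\gamma}(y)\,dy .$$ $L^2([-1,1]^2,\varpi_{\alpha,\gamma},\varpi_{\beta,\gamma})$ is the space of functions on the boundary of $[-1,1]^2$ with $f(\pm1,\pm1)$ finite and $\|f\|_{L^2(\varpi_{\alpha,\gamma},\varpi_{\beta,\gamma})}=\langle f,f\rangle^{1/2}<\infty$. $S_nf$ ($n\ge2$) is the $n$-th partial sum of the Fourier orthogonal expansion of $f$ in mutually orthogonal bases of the spaces of orthogonal polynomials of degrees $0,1,2,\dots$ for $\langle\cdot,\cdot\rangle$ modulo $\langle(1-x^2)(1-y^2)\rangle$; equivalently the orthogonal projection of $f$ onto (restrictions to the boundary of) polynomials of total degree at most $n$. Wedge: $\Omega=\{(x_1,1):x_1\in[0,1]\}\cup\{(1,x_2):x_2\in[0,1]\}$. For $\delta_1,\delta_2\in\{0,1\}$, $a=\alpha+\delta_1$,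 $b=\beta+\delta_2$, $$\langle f,g\rangle_{a,b,\gamma}=c_{a,\gamma}\int_0^1f(x,1)g(x,1)w_{a,\gamma}(x)\,dx+\sigma_{\delta_1,\delta_2}c_{b,\gamma}\int_0^1f(1,y)g(1,y)w_{b,\gamma}(y)\,dy,\qquad \sigma_{\delta_1,\delta_2}=\frac{c_{\beta,\gamma}c_{\alpha+\delta_1,\gamma}}{c_{\alpha,\gamma}c_{\beta+\delta_2,\gamma}},$$ with norm $\|\cdot\|_{a,b,\gamma}$, and $S_n^{a,b,\gamma}$ is the $n$-th partial sum of the Fourier orthogonal expansion with respect to it, i.e. the orthogonal projection onto (restrictions to $\Omega$ of) polynomials of total degree at most $n$. $s_n^{a,\gamma}$ is the orthogonal projection in $L^2(w_{a,\gamma})$ onto univariate polynomials of degree at most $n$. For $f\in L^2([-1,1]^2,\varpi_{\alpha,\gamma},\varpi_{\beta,\gamma})$ set $F_{e,e}=\frac14[f(x,y)+f(-x,y)+f(x,-y)+f(-x,-y)]$, $F_{e,o}=\frac14[f(x,y)+f(-x,y)-f(x,-y)-f(-x,-y)]$, $F_{o,e}=\frac14[f(x,y)-f(-x,y)+f(x,-y)-f(-x,-y)]$, $F_{o,o}=\frac14[f(x,y)-f(-x,y)-f(x,-y)+f(-x,-y)]$, and $G_{0,0}=F_{e,e}$, $G_{0,1}=y^{-1}F_{e,o}$, $G_{1,0}=x^{-1}F_{o,e}$, $G_{1,1}=x^{-1}y^{-1}F_{o,o}$ (defined almost everywhere on the boundary). Let $\psi(x,y)=(\sqrt x,\sqrt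 y)$, which maps $\Omega$ into the boundary of the square; $G_{\delta_1,\delta_2}\circ\psi$ is square integrable on $\Omega$ for $\langle\cdot,\cdot\rangle_{\alpha+\delta_1,\beta+\delta_2,\gamma}$. *)

(* Defs.v *)
From HB Require Import structures.
From mathcomp Require Import all_boot all_order all_algebra.
From mathcomp Require Import all_classical all_reals all_analysis.

Set Implicit Arguments.
Unset Strict Implicit.
Unset Printing Implicit Defensive.

Import Order.TTheory GRing.Theory Num.Theory.
Import numFieldNormedType.Exports.
Local Open Scope classical_set_scope.
Local Open Scope ring_scope.

(* Functions on the boundary of the square, or on the wedge, are represented
   by total functions R * R -> R; only their values on these sets are used. *)

Section Weights.
Context {R : realType}.
Local Notation mu := (@lebesgue_measure R).

Definition jacobi_weight (a c : R) (x : R) : R := x `^ a * (1 - x) `^ c.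

Definition jacobi_const (a c : R) : R :=
  (\int[mu]_(x in `[0, 1]) jacobi_weight a c x)^-1.

Definition sym_weight (a c : R) (x : R) : R :=
  `|x| `^ (2 * a + 1) * (1 - x ^+ 2) `^ c.

Definition in_L2 (D : set R) (v g : R -> R) : Prop :=
  measurable_fun D g /\ mu.-integrable D (fun x => (g x ^+ 2 * v x)%:E).

End Weights.

Section Projection.
Context {R : realType}.

(* The element g of V with f - g orthogonal to V. In all uses below V is a
   finite-dimensional space of polynomials, so that g exists for every square
   integrable f, and its restriction to the set carrying the inner product is
   unique; g is the partial sum of the orthogonal expansion of f. *)
Definition orth_proj (T : Type) (ip : (T -> R) -> (T -> R) -> R)
    (V : set (T -> R)) (f : T -> R) : T -> R :=
  get [set g | V g /\ forall q, V q -> ip (f \- g) q = 0].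

Definition poly1_le (n : nat) : set (R -> R) :=
  [set g | exists2 p : {poly R}, (size p <= n.+1)%N & forall x, g x = p.[x]].

Definition poly2_le (n : nat) : set (R * R -> R) :=
  [set g | exists c : nat -> nat -> R, forall x y,
     g (x, y) = \sum_(i < n.+1) \sum_(j < n.+1 | (i + j <= n)%N)
                  c i j * x ^+ i * y ^+ j].

End Projection.

Section Interval.
Context {R : realType}.
Local Notation mu := (@lebesgue_measure R).

Definition jacobi_ip (a c : R) (f g : R -> R) : R :=
  \int[mu]_(x in `[0, 1]) (f x * g x * jacobi_weight a c x).

Definition jacobi_norm (a c : R) (f : R -> R) : R :=
  Num.sqrt (jacobi_ip a c f f).

Definition jacobi_proj (a c : R) (n : nat) (f : R -> R) : R -> R :=
  orth_proj (jacobi_ip a c) (poly1_le n) f.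

End Interval.

Section Square.
Context {R : realType}.
Local Notation mu := (@lebesgue_measure R).
Implicit Types (alpha beta gamma : R) (f g : R * R -> R).

Definition square_bd : set (R * R) := [set p | Num.max `|p.1| `|p.2| = 1].

Definition square_ip alpha beta gamma f g : R :=
  jacobi_const alpha gamma * \int[mu]_(x in `[-1, 1])
    ((f (x, -1) * g (x, -1) + f (x, 1) * g (x, 1)) * sym_weight alpha gamma x)
  + jacobi_const beta gamma * \int[mu]_(y in `[-1, 1])
    ((f (-1, y) * g (-1, y) + f (1, y) * g (1, y)) * sym_weight beta gamma y).

Definition square_norm alpha beta gamma f : R :=
  Num.sqrt (square_ip alpha beta gamma f f).

Definition square_L2 alpha beta gamma f : Prop :=
  [/\ in_L2 `[-1, 1] (sym_weight alpha gamma) (fun x => f (x, -1)),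
      in_L2 `[-1, 1] (sym_weight alpha gamma) (fun x => f (x, 1)),
      in_L2 `[-1, 1] (sym_weight beta gamma) (fun y => f (-1, y)) &
      in_L2 `[-1, 1] (sym_weight beta gamma) (fun y => f (1, y))].

Definition square_proj alpha beta gamma (n : nat) f : R * R -> R :=
  orth_proj (square_ip alpha beta gamma) (poly2_le n) f.

End Square.

(* A boolean d stands for delta in {0, 1}, and for even (d = 0) or odd (d = 1)
   parity in the corresponding variable. *)
Section Wedge.
Context {R : realType}.
Local Notation mu := (@lebesgue_measure R).
Implicit Types (alpha beta gamma : R) (f g : R * R -> R).

Definition wedge_sigma alpha beta gamma (d1 d2 : bool) : R :=
  (jacobi_const beta gamma * jacobi_const (alpha + d1%:R) gamma) /
  (jacobi_const alpha gamma * jacobi_const (beta + d2%:R) gamma).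

Definition wedge_ip alpha beta gamma (d1 d2 : bool) f g : R :=
  jacobi_const (alpha + d1%:R) gamma * \int[mu]_(x in `[0, 1])
    (f (x, 1) * g (x, 1) * jacobi_weight (alpha + d1%:R) gamma x)
  + wedge_sigma alpha beta gamma d1 d2 *
    jacobi_const (beta + d2%:R) gamma * \int[mu]_(y in `[0, 1])
    (f (1, y) * g (1, y) * jacobi_weight (beta + d2%:R) gamma y).

Definition wedge_norm alpha beta gamma (d1 d2 : bool) f : R :=
  Num.sqrt (wedge_ip alpha beta gamma d1 d2 f f).

Definition wedge_proj alpha beta gamma (d1 d2 : bool) (n : nat) f : R * R -> R :=
  orth_proj (wedge_ip alpha beta gamma d1 d2) (poly2_le n) f.

Definition parity_part (d1 d2 : bool) f (p : R * R) : R :=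
  4^-1 * (f (p.1, p.2) + (-1) ^+ d1 * f (- p.1, p.2)
          + (-1) ^+ d2 * f (p.1, - p.2)
          + (-1) ^+ (d1 + d2) * f (- p.1, - p.2)).

(* x^-d1 y^-d2 F; where x = 0 and d1 = 1 (or y = 0 and d2 = 1), a null set of
   the boundary, the convention 0^-1 = 0 gives the value 0. *)
Definition parity_quot (d1 d2 : bool) f (p : R * R) : R :=
  p.1 ^- d1 * p.2 ^- d2 * parity_part d1 d2 f p.

Definition psi (p : R * R) : R * R := (Num.sqrt p.1, Num.sqrt p.2).

Definition wedge_part (d1 d2 : bool) f : R * R -> R := parity_quot d1 d2 f \o psi.

(* (h x - l) / (1 - x), with value 0 at x = 1. *)
Definition diff_quot (l : R) (h : R -> R) (x : R) : R := (h x - l) / (1 - x).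

End Wedge.

(* Main.v *)
Require Import Defs.
From HB Require Import structures.
From mathcomp Require Import all_boot all_order all_algebra.
From mathcomp Require Import all_classical all_reals all_analysis.
From mathcomp Require Import measurable_realfun zify ring lra.

Set Implicit Arguments.
Unset Strict Implicit.
Unset Printing Implicit Defensive.

Import Order.TTheory GRing.Theory Num.Theory.
Import numFieldNormedType.Exports.
Local Open Scope classical_set_scope.
Local Open Scope ring_scope.

(** Both formulas express that the square is an orthogonal sum of four wedges.
    Splitting a function on the boundary of the square by the parities of x and
    y, dividing the odd parts by x, y or x y and substituting t = x^2 sends it to
    four functions on the wedge. Products of different parities integrate to 0
    over the square, and the divided power of x turns x^(2 alpha + 1) into the
    weight of exponent alpha + d1; square_parseval therefore writes the inner
    product of the square as a combination, with positive constants, of the four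
    inner products of the wedge. The map also sends polynomials of degree n on
    the square onto quadruples of polynomials of degrees
    floor((n - d1 - d2) / 2) (poly_unfold_parts, unfold_parts_poly). Hence the
    partial sum on the square is assembled from the four partial sums on the
    wedge (square_proj_parts), and the square of the error is the combination of
    the squares of the four errors, which gives the first inequality
    (square_error_le).

    The inequality on the wedge asks for a good approximation of H by one
    polynomial of total degree k on the two edges. If p1 and p2 are univariate
    polynomials of degree k, close to H1 and H2, with the common value H(1,1) at
    1, then p1(x) + p2(y) - H(1,1) is such a polynomial (wedge_error_le). So it
    suffices to approximate a function h on [0, 1] by a polynomial of degree k
    with the value h(1) at 1 (corner_approximation). The best approximation p of
    h lacks that value. With q the best approximation of the difference quotient
    of h at 1, for the weight multiplied by (1 - x)^2, the polynomial
    h(1) + (1 - x) q has the right value and is close to h, but has degree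
    k + 1. The difference D of the two is small, and degree_reduction replaces it
    by a polynomial of degree k with the same value at 1 and a norm larger by a
    bounded factor, which is added to p.

    The degree is lowered by subtracting from D a multiple of (x - 1) N, where N
    is the monic orthogonal polynomial of degree k for the weight multiplied by
    (1 - x)^2. This is harmless when the norm of (x - 1) N is comparable,
    uniformly in k, with the least norm of a monic polynomial of degree k + 1.
    Write e_k(a, c) for the square of the least norm of a monic polynomial of
    degree k for the weight of exponents a, c. The derivative of an orthogonal
    polynomial is one for a + 1, c + 1, and integration by parts gives
      (k + a + c + 2) e_(k+1)(a, c) = (k + 1) e_k(a + 1, c + 1)
    (monic_norm_deriv), whence by induction
      (a + 1 + k) e_k(a, c + 1) = (c + 1 + k) e_k(a + 1, c)
    (monic_norm_shift). The two identities express e_k(a, c + 2) as a bounded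
    multiple of e_(k+1)(a, c).

    Square integrable functions are only measurable, so the substitution t = x^2
    is made on measures: the square root of a uniform variable has the
    Beta(2, 1) law (beta_prob_sqrt). *)

(** * Semi-inner products and orthogonal projections *)

Section SemiInnerProduct.
Context {R : realType}.

Definition lin_closed (T : Type) (W : set (T -> R)) : Prop :=
  W (fun=> 0) /\ forall a f g, W f -> W g -> W (fun x => f x + a * g x).

(** Positivity is not strict: functions that vanish almost everywhere, or off the
    set carrying the inner product, have norm 0. The laws are confined to the
    space W of square integrable functions, outside which integrals are
    conventional values. *)
Record semi_ip (T : Type) (W : set (T -> R))
    (ip : (T -> R) -> (T -> R) -> R) : Prop := SemiIp {
  sip_closed : lin_closed W;
  sipC : forall f g, W f -> W g -> ip f g = ip g f;
  sip_linl : forall a f g h, W f -> W g -> W h ->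
    ip (fun x => f x + a * g x) h = ip f h + a * ip g h;
  sip_ge0 : forall f, W f -> 0 <= ip f f }.

Fixpoint span (T : Type) (es : seq (T -> R)) : set (T -> R) :=
  if es is e :: es' then
    [set g | exists2 h, span es' h & exists a, g = fun x => h x + a * e x]
  else [set fun=> 0].

Definition projectable (T : Type) (ip : (T -> R) -> (T -> R) -> R)
    (V : set (T -> R)) (f : T -> R) :=
  exists2 g, V g & forall q, V q -> ip (f \- g) q = 0.

Lemma span_lin_closed (T : Type) (es : seq (T -> R)) : lin_closed (span es).
Proof.
elim: es => [|e es [IH0 IH]] /=.
  split=> // a f g -> ->; apply/funext => x; ring.
split; first by exists (fun=> 0) => //; exists 0; apply/funext => x; ring.
move=> a f g [f' sf' [b ->]] [g' sg' [c ->]].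
exists (fun x => f' x + a * g' x); first exact: IH.
by exists (b + a * c); apply/funext => x; ring.
Qed.

Lemma span_sub (T : Type) (es : seq (T -> R)) (V : set (T -> R)) :
  lin_closed V -> (forall e, List.In e es -> V e) -> span es `<=` V.
Proof.
move=> [V0 Vlin]; elim: es => [|e es IH] /= esV; first by move=> _ ->.
move=> _ [h sh [a ->]]; apply: Vlin; last by apply: esV; left.
by apply: IH sh => e' ?; apply: esV; right.
Qed.

Lemma span_sum (T I : Type) (s : seq I) (e : I -> T -> R) (c : I -> R) :
  span [seq e i | i <- s] (fun x => \sum_(i <- s) c i * e i x).
Proof.
elim: s => [|i s IH] /=; first by apply/funext => x; rewrite big_nil.
by eexists; [exact: IH|exists (c i)]; apply/funext => x; rewrite big_cons addrC.
Qed.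

Section Theory.
Variables (T : Type) (W : set (T -> R)) (ip : (T -> R) -> (T -> R) -> R).
Hypothesis sip : semi_ip W ip.
Implicit Types f g h : T -> R.

Lemma lin_closedB f g : W f -> W g -> W (f \- g).
Proof.
move=> Wf Wg.
rewrite (_ : f \- g = fun x => f x + (-1) * g x).
  by apply: (sip_closed sip).2.
by apply/funext => x; rewrite mulN1r.
Qed.

Lemma sipBl f g h : W f -> W g -> W h -> ip (f \- g) h = ip f h - ip g h.
Proof.
move=> Wf Wg Wh.
rewrite (_ : f \- g = fun x => f x + (-1) * g x).
  by rewrite (sip_linl sip)// mulN1r.
by apply/funext => x; rewrite mulN1r.
Qed.

Lemma sip_linr a f g h : W f -> W g -> W h ->
  ip h (fun x => f x + a * g x) = ip h f + a * ip h g.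
Proof.
move=> Wf Wg Wh; rewrite (sipC sip)//; last by apply: (sip_closed sip).2.
by rewrite (sip_linl sip)// (sipC sip Wf)// (sipC sip Wg).
Qed.

Lemma sip_sqr a f g : W f -> W g ->
  ip (fun x => f x + a * g x) (fun x => f x + a * g x) =
  ip f f + 2 * a * ip f g + a ^+ 2 * ip g g.
Proof.
move=> Wf Wg; have Wfg := (sip_closed sip).2 a _ _ Wf Wg.
rewrite (sip_linl sip)// !sip_linr// (sipC sip Wg Wf); ring.
Qed.

Lemma sip_CS f g : W f -> W g -> ip f g ^+ 2 <= ip f f * ip g g.
Proof.
move=> Wf Wg.
have Q a : 0 <= ip f f + 2 * a * ip f g + a ^+ 2 * ip g g.
  by rewrite -sip_sqr//; apply: (sip_ge0 sip); apply: (sip_closed sip).2.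
have := sip_ge0 sip Wg; rewrite le_eqVlt => /orP[/eqP g0|g0].
  rewrite -g0 mulr0.
  have [->|nz] := eqVneq (ip f g) 0; first by rewrite expr0n.
  have := Q (- (ip f f + 1) / (2 * ip f g)); rewrite -g0 mulr0 addr0.
  rewrite (_ : 2 * _ * _ = - (ip f f + 1)); last by field.
  by lra.
have := Q (- ip f g / ip g g).
rewrite (_ : _ + _ = (ip f f * ip g g - ip f g ^+ 2) / ip g g); last first.
  by field; rewrite gt_eqF.
by rewrite pmulr_lge0 ?invr_gt0//; lra.
Qed.

(** This replaces definiteness in the arguments below. *)
Lemma sip_isotropic f g : W f -> W g -> ip g g = 0 -> ip f g = 0.
Proof.
move=> Wf Wg g0; have := sip_CS Wf Wg; rewrite g0 mulr0 => h.
by apply/eqP; rewrite -sqrf_eq0 eq_le h sqr_ge0.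
Qed.

Lemma sip_triangle f g : W f -> W g ->
  Num.sqrt (ip (f \+ g) (f \+ g)) <= Num.sqrt (ip f f) + Num.sqrt (ip g g).
Proof.
move=> Wf Wg.
have nn : 0 <= Num.sqrt (ip f f) + Num.sqrt (ip g g) by rewrite addr_ge0 ?sqrtr_ge0.
rewrite -(ger0_norm nn) -sqrtr_sqr; apply: ler_wsqrtr.
rewrite sqrrD !sqr_sqrtr ?(sip_ge0 sip)//.
rewrite (_ : f \+ g = fun x => f x + 1 * g x); last first.
  by apply/funext => x; rewrite mul1r.
rewrite sip_sqr// expr1n mul1r mulr1.
have : ip f g <= Num.sqrt (ip f f) * Num.sqrt (ip g g).
  rewrite -sqrtrM ?(sip_ge0 sip)//; apply: le_trans (ler_norm _) _.
  by rewrite -sqrtr_sqr ler_wsqrtr// sip_CS.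
lra.
Qed.

Section Projections.
Variable V : set (T -> R).
Hypotheses (Vlin : lin_closed V) (VW : V `<=` W).

Lemma orth_projP f : projectable ip V f ->
  V (orth_proj ip V f) /\ forall q, V q -> ip (f \- orth_proj ip V f) q = 0.
Proof.
move=> [g Vg gP]; rewrite /orth_proj.
by case: (getPex (P := [set g | V g /\ forall q, V q -> ip (f \- g) q = 0])
  (ex_intro _ g (conj Vg gP))).
Qed.

Let VB g h : V g -> V h -> V (h \- g).
Proof.
move=> Vg Vh; rewrite (_ : h \- g = fun x => h x + (-1) * g x).
  by apply: Vlin.2.
by apply/funext => x; rewrite mulN1r.
Qed.

(** Two candidates for the projection differ by an element of V orthogonal to V,
    hence to itself. *)
Lemma orth_unique f g h : W f -> V g -> V h ->
  (forall q, V q -> ip (f \- g) q = 0) ->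
  (forall q, V q -> ip (f \- h) q = 0) ->
  ip (h \- g) (h \- g) = 0.
Proof.
move=> Wf Vg Vh gP hP; have Vhg := VB Vg Vh.
have := gP _ Vhg; have := hP _ Vhg.
rewrite !sipBl//; try exact: VW.
move=> /eqP; rewrite subr_eq0 => /eqP <- /eqP.
by rewrite subr_eq0 => /eqP ->; rewrite subrr.
Qed.

(** Pythagoras: g - f is orthogonal to p - g. *)
Lemma orth_best f g p : W f -> V g -> V p ->
  (forall q, V q -> ip (f \- g) q = 0) ->
  ip (g \- f) (g \- f) <= ip (p \- f) (p \- f).
Proof.
move=> Wf Vg Vp gP; have Vpg := VB Vg Vp.
have Wg := VW Vg; have Wp := VW Vp; have Wpg := VW Vpg.
have Wgf := lin_closedB Wg Wf.
have -> : p \- f = fun x => (g \- f) x + 1 * (p \- g) x.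
  by apply/funext => x /=; rewrite mul1r; ring.
rewrite sip_sqr//.
have -> : ip (g \- f) (p \- g) = 0.
  have := gP _ Vpg; rewrite !sipBl// => /eqP; rewrite subr_eq0 => /eqP ->.
  by rewrite subrr.
by rewrite mulr0 addr0 expr1n mul1r lerDl (sip_ge0 sip).
Qed.

End Projections.

(** Gram-Schmidt. Adjoining a vector e to the span amounts to adjoining its
    component u orthogonal to the span. When u is isotropic, it is orthogonal to
    all of W and the coefficient a / 0 = 0 is the right one. *)
Lemma span_projectable (es : seq (T -> R)) f :
  (forall e, List.In e es -> W e) -> W f -> projectable ip (span es) f.
Proof.
elim: es f => [|e es IH] f esW Wf /=.
  exists (fun=> 0) => // q ->.
  apply: sip_isotropic; [|exact: (sip_closed sip).1|].
    by apply: lin_closedB => //; exact: (sip_closed sip).1.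
  have W0 := (sip_closed sip).1.
  rewrite (_ : ip _ _ = ip (fun x : T => 0 - 0) (fun=> 0)).
    by rewrite (sipBl W0 W0 W0) subrr.
  by congr ip; apply/funext => x; rewrite subrr.
have We : W e by apply: esW; left.
have esW' e' : List.In e' es -> W e' by move=> ?; apply: esW; right.
have [f0 sf0 f0P] := IH f esW' Wf.
have [e0 se0 e0P] := IH e esW' We.
have spW : span es `<=` W by apply: span_sub esW'; exact: (sip_closed sip).
have Wf0 := spW _ sf0; have We0 := spW _ se0.
have Wu : W (e \- e0) by exact: lin_closedB.
have Wff0 : W (f \- f0) by exact: lin_closedB.
pose b := ip (f \- f0) (e \- e0) / ip (e \- e0) (e \- e0).
exists (fun x => f0 x + b * (e x - e0 x)).
  exists (fun x => f0 x + (- b) * e0 x); first exact: (span_lin_closed _).2.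
  by exists b; apply/funext => x; ring.
move=> _ [h sh [a ->]].
have Wh := spW _ sh.
rewrite (_ : (fun x => h x + a * e x) =
  fun x => (fun y => h y + a * e0 y) x + a * (e \- e0) x); last first.
  by apply/funext => x /=; ring.
have sh' : span es (fun y => h y + a * e0 y) by exact: (span_lin_closed _).2.
have Wh' := spW _ sh'.
rewrite (_ : (f \- _) = fun x => (f \- f0) x + (- b) * (e \- e0) x); last first.
  by apply/funext => x /=; ring.
rewrite (sip_linl sip)//; last exact: (sip_closed sip).2.
rewrite !sip_linr// (f0P _ sh) (f0P _ se0) (e0P _ sh) (e0P _ se0).
rewrite mulr0 !add0r mulrCA -mulrDr.
suff -> : ip (f \- f0) (e \- e0) + - b * ip (e \- e0) (e \- e0) = 0.
  by rewrite mulr0.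
rewrite /b; have [u0|u0] := eqVneq (ip (e \- e0) (e \- e0)) 0; last by field.
by rewrite u0 mulr0 addr0; exact: sip_isotropic.
Qed.

Lemma fin_projectable (V : set (T -> R)) (I : Type) (s : seq I)
    (e : I -> T -> R) f :
  lin_closed V -> V `<=` W -> (forall i, V (e i)) ->
  (forall g, V g -> exists c, g = fun x => \sum_(i <- s) c i * e i x) ->
  W f -> projectable ip V f.
Proof.
move=> Vlin VW Ve Vs Wf.
have esV e' : List.In e' [seq e i | i <- s] -> V e'.
  by elim: s {Vs} => //= i s IH [<-|//].
have [g sg gP] : projectable ip (span [seq e i | i <- s]) f.
  by apply: span_projectable => // e' /esV /VW.
exists g; first exact: span_sub sg.
by move=> q /Vs[c ->]; apply: gP; exact: span_sum.
Qed.

End Theory.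

Lemma semi_ip_pullback (S T : Type) (phi : (T -> R) -> (S -> R))
    (W : set (S -> R)) ip :
  (forall a f g, phi (fun x => f x + a * g x) = fun x => phi f x + a * phi g x) ->
  semi_ip W ip -> semi_ip (phi @^-1` W) (fun f g => ip (phi f) (phi g)).
Proof.
move=> phil [[W0 Wl] C L P]; split => //=.
- split=> [|a f g Wf Wg] /=; last by rewrite phil; exact: Wl.
  rewrite (_ : phi _ = fun=> 0)//.
  have := phil (-1) (fun=> 0) (fun=> 0); rewrite (_ : (fun x => _) = fun=> 0).
    by move=> ->; apply/funext => x; ring.
  by apply/funext => x; ring.
- by move=> f g; exact: C.
- by move=> a f g h Wf Wg Wh; rewrite phil; exact: L.
- by move=> f; exact: P.
Qed.

Lemma semi_ip_comb (T : Type) (W1 W2 : set (T -> R)) ip1 ip2 (A B : R) :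
  0 <= A -> 0 <= B -> semi_ip W1 ip1 -> semi_ip W2 ip2 ->
  semi_ip (W1 `&` W2) (fun f g => A * ip1 f g + B * ip2 f g).
Proof.
move=> A0 B0 [[W10 W1l] C1 L1 P1] [[W20 W2l] C2 L2 P2]; split.
- by split=> // a f g [? ?] [? ?]; split; [exact: W1l|exact: W2l].
- by move=> f g [? ?] [? ?]; rewrite C1// C2.
- by move=> a f g h [? ?] [? ?] [? ?]; rewrite L1// L2//; ring.
- by move=> f [? ?]; rewrite addr_ge0// mulr_ge0// ?P1 ?P2.
Qed.

End SemiInnerProduct.

(** * The Jacobi weight *)

Section WeightedL2.
Context {R : realType}.
Local Notation mu := (@lebesgue_measure R).
Variables (D : set R) (v : R -> R).
Hypotheses (mD : measurable D) (mv : measurable_fun D v).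
Hypothesis v0 : forall x, D x -> 0 <= v x.

(** 2 |f g| <= f^2 + g^2. *)
Lemma in_L2_mul f g : in_L2 D v f -> in_L2 D v g ->
  mu.-integrable D (fun x => (f x * g x * v x)%:E).
Proof.
move=> [mf If] [mg Ig].
apply: (@le_integrable _ _ _ mu D mD _
    (fun x => (f x ^+ 2 * v x)%:E + (g x ^+ 2 * v x)%:E)%E).
- apply/measurable_EFinP; apply: measurable_funM => //; exact: measurable_funM.
- move=> x Dx; rewrite -EFinD !abse_EFin lee_fin.
  rewrite [leRHS]ger0_norm; last first.
    by rewrite addr_ge0// mulr_ge0 ?sqr_ge0 ?v0.
  rewrite normrM (ger0_norm (v0 Dx)) -mulrDl ler_wpM2r ?v0//.
  by rewrite ler_norml; apply/andP; split; nra.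
- exact: integrableD.
Qed.

Lemma in_L2_semi_ip : semi_ip (in_L2 D v)
  (fun f g => \int[mu]_(x in D) (f x * g x * v x)).
Proof.
split.
- split.
    split; first exact: measurable_cst.
    by under eq_fun do rewrite expr0n mul0r; exact: integrable0.
  move=> a f g Lf Lg; have [mf If] := Lf; have [mg Ig] := Lg; split.
    by apply: measurable_funD => //; exact: measurable_funM.
  have -> : (fun x => ((f x + a * g x) ^+ 2 * v x)%:E) =
    (fun x => ((f x ^+ 2 * v x)%:E + ((2 * a)%:E * (f x * g x * v x)%:E +
       (a ^+ 2)%:E * (g x ^+ 2 * v x)%:E))%E).
    by apply/funext => x; rewrite -!EFinM -!EFinD; congr EFin; ring.
  apply: integrableD => //; apply: integrableD => //; apply: integrableZl => //.
  exact: in_L2_mul.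
- by move=> f g _ _; apply: eq_Rintegral => x _; ring.
- move=> a f g h Lf Lg Lh.
  rewrite -RintegralZl//; last exact: in_L2_mul.
  rewrite -RintegralD//.
  + by apply: eq_Rintegral => x _; ring.
  + exact: in_L2_mul.
  + rewrite (_ : _ \o _ = fun x => (a%:E * (g x * h x * v x)%:E)%E).
      by apply: integrableZl => //; exact: in_L2_mul.
    by apply/funext => x /=; rewrite EFinM.
- move=> f _; apply: Rintegral_ge0 => x Dx.
  by rewrite -expr2 mulr_ge0 ?sqr_ge0 ?v0.
Qed.

End WeightedL2.

Section JacobiWeight.
Context {R : realType}.
Local Notation mu := (@lebesgue_measure R).
Local Notation w := (@jacobi_weight R).
Local Notation oo01 := (`](0%R : R), (1%R : R)[%classic).
Local Notation cc01 := (`[(0%R : R), (1%R : R)]%classic).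
Implicit Types a c p q x : R.

Lemma jacobi_weight_ge0 a c x : 0 <= w a c x.
Proof. by rewrite mulr_ge0 ?powR_ge0. Qed.

Lemma measurable_jacobi_weight a c : measurable_fun setT (w a c).
Proof.
apply: measurable_funM; first exact: (measurable_powR a).
have m1 : measurable_fun setT (fun x : R => 1 - x) by exact: measurable_funB.
exact: (measurableT_comp (measurable_powR c) m1).
Qed.

Lemma jacobi_weightDl a c x : -1 < a -> 0 <= x -> w (a + 1) c x = x * w a c x.
Proof.
move=> a1 x0; rewrite /w mulrA; congr (_ * _).
by rewrite -(mulr_powRB1 x0 (p := a + 1)) ?addrK//; lra.
Qed.

Lemma jacobi_weightDr a c x : -1 < c -> x <= 1 ->
  w a (c + 1) x = (1 - x) * w a c x.
Proof.
move=> c1 x1; rewrite /w mulrCA; congr (_ * _).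
by rewrite -(mulr_powRB1 (x := 1 - x) (p := c + 1)) ?addrK//; lra.
Qed.

Lemma is_derive_jacobi_weight p q x : 0 < x < 1 ->
  is_derive x 1 (w p q) (p * w (p - 1) q x - q * w p (q - 1) x).
Proof.
move=> /andP[x0 x1]; have y0 : 0 < 1 - x by lra.
have D1 := is_derive1_powR p x0.
have D2 : is_derive x 1 (fun y => 1 - y) (-1).
  by apply: is_derive_eq; ring.
have D3 := @is_derive1_comp R (@powR R ^~ q) (fun y => 1 - y) x _ _
  (is_derive1_powR q y0) D2.
have := is_deriveM D1 D3; rewrite /w => D; apply: is_derive_eq D _.
by rewrite /= /GRing.scale /=; ring.
Qed.

Lemma continuous_jacobi_weight p q x : 0 < x < 1 -> {for x, continuous (w p q)}.
Proof.
move=> x01; apply: differentiable_continuous; apply/derivable1_diffP.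
by have [] := is_derive_jacobi_weight p q x01.
Qed.

Lemma FTC_is_derive (f F : R -> R) (a b : R) : a < b ->
  (forall x, a <= x <= b -> is_derive x 1 F (f x)) ->
  (forall x, a <= x <= b -> {for x, continuous f}) ->
  (\int[mu]_(x in `[a, b]) (f x)%:E = (F b)%:E - (F a)%:E)%E.
Proof.
move=> ab dF cf.
have cF x : a <= x <= b -> {for x, continuous F}.
  move=> xab; apply: differentiable_continuous; apply/derivable1_diffP.
  by have [] := dF _ xab.
apply: continuous_FTC2 => //.
- by apply/continuous_in_subspaceT => x; rewrite inE/= in_itv/=; exact: cf.
- split.
  + move=> x; rewrite in_itv/= => /andP[ax xb].
    by have [] := dF x; rewrite ?(ltW ax) ?(ltW xb).
  + by apply: cvg_at_right_filter; apply: cF; rewrite lexx ltW.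
  + by apply: cvg_at_left_filter; apply: cF; rewrite lexx ltW.
- move=> x; rewrite in_itv/= => /andP[ax xb].
  by rewrite derive1E; have [] := dF x; rewrite ?(ltW ax) ?(ltW xb).
Qed.

(** Compact intervals exhausting ]0, 1[, away from the singularities of the
    weight at both ends. The offset 3 keeps them nondegenerate. *)
Definition inner_itv (n : nat) : set R := `[n.+3%:R^-1, 1 - n.+3%:R^-1].

Lemma inner_itv_bounds n : 0 < n.+3%:R^-1 :> R /\ n.+3%:R^-1 < 1 - n.+3%:R^-1 :> R.
Proof.
split; first by rewrite invr_gt0.
have : n.+3%:R^-1 <= 3^-1 :> R by rewrite lef_pV2 ?posrE// ler_nat.
by move: (_^-1) => e; lra.
Qed.

Lemma inner_itv_sub n : inner_itv n `<=` `]0, 1[.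
Proof.
have [a0 ab] := inner_itv_bounds n.
move=> x; rewrite /inner_itv /= !in_itv/=; move: (n.+3%:R^-1) a0 ab => e a0 ab.
by move=> /andP[? ?]; apply/andP; split; lra.
Qed.

Lemma bigcup_inner_itv : \bigcup_n inner_itv n = oo01.
Proof.
rewrite eqEsubset; split; first by move=> x [n _]; exact: inner_itv_sub.
move=> x /=; rewrite in_itv/= => /andP[x0 x1].
have m0 : 0 < Num.min x (1 - x) by rewrite lt_min x0/=; lra.
have [n _ nP] := near_infty_natSinv_lt (PosNum m0).
exists n => //; rewrite /inner_itv /= in_itv/=.
have : n.+3%:R^-1 < Num.min x (1 - x).
  apply: le_lt_trans (nP n (leqnn n)).
  by rewrite lef_pV2 ?posrE// ler_nat !ltnS -addn2 leq_addr.
rewrite lt_min; move: (_^-1) => e.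
by move=> /andP[? ?]; apply/andP; split; lra.
Qed.

Lemma nondecreasing_inner_itv : nondecreasing_seq inner_itv.
Proof.
move=> m n mn; rewrite subsetEset => x; rewrite /inner_itv /= !in_itv/=.
have : n.+3%:R^-1 <= m.+3%:R^-1 :> R by rewrite lef_pV2 ?posrE// ler_nat !ltnS.
move: (n.+3%:R^-1) (m.+3%:R^-1) => e e' ee' /andP[? ?].
by apply/andP; split; lra.
Qed.

Lemma cvg_integral_inner_itv (f : R -> R) : measurable_fun oo01 f ->
  (forall x, 0 < x < 1 -> 0 <= f x) ->
  (\int[mu]_(x in inner_itv n) (f x)%:E @[n --> \oo] -->
     \int[mu]_(x in oo01) (f x)%:E)%E.
Proof.
move=> mf f0; rewrite -bigcup_inner_itv.
apply: ge0_nondecreasing_set_cvg_integral.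
- exact: nondecreasing_inner_itv.
- by move=> n; exact: measurable_itv.
- move=> n; apply/measurable_EFinP.
  by apply: measurable_funS mf => //; exact: inner_itv_sub.
- move=> n x /inner_itv_sub /=; rewrite in_itv/= => ?.
  by rewrite lee_fin f0.
Qed.

(** On the compact intervals the integral is a difference of values of F, hence
    at most 2 M; monotone convergence passes to ]0, 1[. *)
Lemma integrable_bounded_primitive (f F : R -> R) M :
  measurable_fun oo01 f -> (forall x, 0 < x < 1 -> 0 <= f x) ->
  (forall x, 0 < x < 1 -> is_derive x 1 F (f x)) ->
  (forall x, 0 < x < 1 -> {for x, continuous f}) ->
  (forall x, 0 < x < 1 -> `|F x| <= M) ->
  mu.-integrable cc01 (EFin \o f).
Proof.
move=> mf f0 dF cf FM.
apply/integrableP; split.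
  by apply/measurable_EFinP; exact: (measurable_fun_itv_cc mf).
rewrite integral_itv_bndoo; last first.
  by apply: measurableT_comp => //; exact/measurable_EFinP.
under eq_integral => x.
  rewrite inE/= in_itv/= => x01; rewrite ger0_norm ?f0//; over.
rewrite /=.
apply: (@le_lt_trans _ _ (2 * M)%:E); last exact: ltry.
apply: cvge_le (cvg_integral_inner_itv mf f0).
apply: nearW => n; have [a0 ab] := inner_itv_bounds n.
have sub x : n.+3%:R^-1 <= x <= 1 - n.+3%:R^-1 -> 0 < x < 1.
  move: (n.+3%:R^-1) a0 ab => e a0 ab /andP[? ?].
  by apply/andP; split; lra.
rewrite (FTC_is_derive ab (fun x h => dF x (sub x h)) (fun x h => cf x (sub x h))).
rewrite -EFinB lee_fin.
have := FM _ (sub n.+3%:R^-1 _); rewrite lexx (ltW ab) => /(_ isT).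
have := FM _ (sub (1 - n.+3%:R^-1) _); rewrite lexx (ltW ab) => /(_ isT).
by rewrite !ler_norml => /andP[? ?] /andP[? ?]; lra.
Qed.

Lemma powR_le1 p x : 0 <= p -> 0 < x -> x <= 1 -> x `^ p <= 1.
Proof.
by move=> p0 x0 x1; rewrite -(powRr0 x); apply: ger_powR => //; rewrite x0.
Qed.

Lemma powR_half_le p x : 2^-1 <= x -> x <= 1 -> x `^ p <= 1 + 2^-1 `^ p.
Proof.
move=> x2 x1; have x0 : 0 < x by apply: lt_le_trans x2; lra.
have [p0|p0] := leP 0 p.
  by rewrite (le_trans (powR_le1 p0 x0 x1))// lerDl powR_ge0.
rewrite (@le_trans _ _ (2^-1 `^ p))//; last by rewrite lerDr.
rewrite -(opprK p) !(powRN _ (- p)) lef_pV2 ?posrE ?powR_gt0//.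
by apply: ge0_ler_powR => //; rewrite ?nnegrE ?(ltW x0)//; lra.
Qed.

Lemma measurable_jacobi_weightS a c (D : set R) : measurable_fun D (w a c).
Proof. by apply: measurable_funTS; exact: measurable_jacobi_weight. Qed.

Lemma integrable_jacobi_weightl a : -1 < a -> mu.-integrable cc01 (EFin \o w a 0).
Proof.
move=> a1; have p0 : 0 < a + 1 by lra.
apply: (@integrable_bounded_primitive _ (fun x => (a + 1)^-1 * w (a + 1) 0 x)
  (a + 1)^-1).
- exact: measurable_jacobi_weightS.
- by move=> x _; exact: jacobi_weight_ge0.
- move=> x x01; have D := is_derive_jacobi_weight (a + 1) 0 x01.
  have := is_deriveZ (a + 1)^-1 D; rewrite /GRing.scale /= => D'.
  apply: is_derive_eq D' _.
  by rewrite mul0r subr0 addrK mulrA mulVf ?mul1r// gt_eqF.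
- by move=> x x01; exact: continuous_jacobi_weight.
- move=> x /andP[x0 x1]; rewrite normrM !ger0_norm ?jacobi_weight_ge0//; last first.
    by rewrite invr_ge0 ltW.
  rewrite ler_piMr ?invr_ge0 ?(ltW p0)// /w powRr0 mulr1.
  exact: powR_le1 (ltW p0) x0 (ltW x1).
Qed.

Lemma integrable_jacobi_weightr c : -1 < c -> mu.-integrable cc01 (EFin \o w 0 c).
Proof.
move=> c1; have p0 : 0 < c + 1 by lra.
apply: (@integrable_bounded_primitive _ (fun x => - (c + 1)^-1 * w 0 (c + 1) x)
  (c + 1)^-1).
- exact: measurable_jacobi_weightS.
- by move=> x _; exact: jacobi_weight_ge0.
- move=> x x01; have D := is_derive_jacobi_weight 0 (c + 1) x01.
  have := is_deriveZ (- (c + 1)^-1) D; rewrite /GRing.scale /= => D'.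
  apply: is_derive_eq D' _.
  by rewrite mul0r sub0r addrK mulrNN mulrA mulVf ?mul1r// gt_eqF.
- by move=> x x01; exact: continuous_jacobi_weight.
- move=> x /andP[x0 x1]; rewrite normrM normrN !ger0_norm ?jacobi_weight_ge0//; last first.
    by rewrite invr_ge0 ltW.
  rewrite ler_piMr ?invr_ge0 ?(ltW p0)// /w powRr0 mul1r.
  by apply: powR_le1 (ltW p0) _ _; lra.
Qed.

(** On each half of [0, 1] one of the two powers is bounded, and what remains
    is one of the two weights with a single singularity. *)
Lemma integrable_jacobi_weight a c : -1 < a -> -1 < c ->
  mu.-integrable cc01 (EFin \o w a c).
Proof.
move=> a1 c1.
apply: (@le_integrable _ _ _ mu _ _ _ (fun x => ((1 + 2^-1 `^ c)%:E * (w a 0 x)%:E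
    + (1 + 2^-1 `^ a)%:E * (w 0 c x)%:E)%E)) => //=.
- apply/measurable_EFinP; exact: measurable_jacobi_weightS.
- move=> x; rewrite in_itv/= => /andP[x0 x1].
  have nn (p : R) : 0 <= 1 + 2^-1 `^ p by rewrite addr_ge0 ?powR_ge0.
  rewrite lee_fin !ger0_norm ?jacobi_weight_ge0//; last first.
    by rewrite addr_ge0// mulr_ge0 ?nn ?jacobi_weight_ge0.
  rewrite /w !powRr0 mulr1 mul1r.
  have [x2|x2] := leP x 2^-1.
    apply: (@le_trans _ _ ((1 + 2^-1 `^ c) * x `^ a)).
      by rewrite mulrC ler_wpM2r ?powR_ge0// powR_half_le//; lra.
    by rewrite lerDl mulr_ge0 ?nn ?powR_ge0.
  apply: (@le_trans _ _ ((1 + 2^-1 `^ a) * (1 - x) `^ c)).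
    by rewrite ler_wpM2r ?powR_ge0// powR_half_le//; lra.
  by rewrite lerDr mulr_ge0 ?nn ?powR_ge0.
- apply: integrableD => //; apply: integrableZl => //.
    exact: integrable_jacobi_weightl.
  exact: integrable_jacobi_weightr.
Qed.

(** The weight dominates x^n (1 - x)^n for a large integer n, whose integral is a
    value of the beta function. *)
Lemma integral_jacobi_weight_gt0 a c : -1 < a -> -1 < c ->
  0 < \int[mu]_(x in cc01) w a c x.
Proof.
move=> a1 c1.
pose n := (Num.bound `|a| + Num.bound `|c|)%N.
have an : a <= n.+1%:R.
  rewrite (le_trans (ler_norm _))// (le_trans (ltW (archi_boundP _)))//.
  by rewrite ler_nat leqW// leq_addr.
have cn : c <= n.+1%:R.
  rewrite (le_trans (ler_norm _))// (le_trans (ltW (archi_boundP _)))//.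
  by rewrite ler_nat leqW// leq_addl.
apply: (@lt_le_trans _ _ (\int[mu]_(x in cc01) XMonemX n.+1 n.+1 x)).
  have := @beta_fun_gt0 R n.+2 n.+2.
  by rewrite /beta_fun -Rintegral_mkcond.
have powge (p x : R) : p <= n.+1%:R -> 0 <= x -> x <= 1 -> x ^+ n.+1 <= x `^ p.
  move=> pn; rewrite le_eqVlt => /predU1P[<-|x0] x1.
    by rewrite expr0n/= powR_ge0.
  by rewrite -powR_mulrn ?(ltW x0)//; apply: ger_powR => //; rewrite x0.
apply: le_Rintegral => //.
- exact: integrable_XMonemX.
- exact: integrable_jacobi_weight.
- move=> x /=; rewrite in_itv/= => /andP[x0 x1].
  rewrite ler_pM ?exprn_ge0 ?powge// ?subr_ge0//.
  by change (1 - x <= 1); rewrite gerBl.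
Qed.

Lemma cvg_fine_inner_itv a c : -1 < a -> -1 < c ->
  fine (\int[mu]_(x in inner_itv n) (w a c x)%:E)%E @[n --> \oo] -->
  \int[mu]_(x in cc01) w a c x.
Proof.
move=> a1 c1; apply: fine_cvg.
rewrite (_ : _%:E = \int[mu]_(x in oo01) (w a c x)%:E)%E.
  apply: cvg_integral_inner_itv; first exact: measurable_jacobi_weightS.
  by move=> x _; exact: jacobi_weight_ge0.
rewrite /Rintegral fineK; last first.
  by apply: integrable_fin_num => //; exact: integrable_jacobi_weight.
rewrite [LHS]integral_itv_bndoo//.
by apply/measurable_EFinP; exact: measurable_jacobi_weightS.
Qed.

Lemma cvg_powR_inner p : 0 < p -> (n.+3%:R^-1 : R) `^ p @[n --> \oo] --> 0.
Proof.
move=> p0; have /cvg_at_rightP := powR_cvg0 p0.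
apply; split; first by move=> n; rewrite invr_gt0.
have := @cvg_harmonic R; rewrite -(cvg_shiftn 2) /harmonic.
by under eq_fun do rewrite addn2.
Qed.

(** The difference of both sides is the integral of the derivative of
    w (a + 1) (c + 1), which tends to 0 at both ends. *)
Lemma jacobi_weight_by_parts a c : -1 < a -> -1 < c ->
  (a + 1) * \int[mu]_(x in cc01) w a (c + 1) x =
  (c + 1) * \int[mu]_(x in cc01) w (a + 1) c x.
Proof.
move=> a1 c1.
have p0 : 0 < a + 1 by lra.
have q0 : 0 < c + 1 by lra.
pose I a c n := fine (\int[mu]_(x in inner_itv n) (w a c x)%:E)%E.
pose e n : R := n.+3%:R^-1.
have H n : (a + 1) * I a (c + 1) n - (c + 1) * I (a + 1) c n =
    w (a + 1) (c + 1) (1 - e n) - w (a + 1) (c + 1) (e n).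
  have [a0 ab] := inner_itv_bounds n.
  have sub x : n.+3%:R^-1 <= x <= 1 - n.+3%:R^-1 -> 0 < x < 1.
    move: (n.+3%:R^-1) a0 ab => d a0 ab /andP[? ?].
    by apply/andP; split; lra.
  have Iw a' c' : -1 < a' -> -1 < c' ->
      mu.-integrable (inner_itv n) (EFin \o w a' c').
    move=> a'1 c'1; apply: integrableS (integrable_jacobi_weight a'1 c'1) => //.
      exact: measurable_itv.
    by move=> x /inner_itv_sub; exact: subset_itv_oo_cc.
  have dF x : n.+3%:R^-1 <= x <= 1 - n.+3%:R^-1 ->
      is_derive x 1 (w (a + 1) (c + 1))
        ((a + 1) * w a (c + 1) x - (c + 1) * w (a + 1) c x).
    move=> /sub x01; have D := is_derive_jacobi_weight (a + 1) (c + 1) x01.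
    by apply: is_derive_eq D _; rewrite !addrK.
  have cf x : n.+3%:R^-1 <= x <= 1 - n.+3%:R^-1 ->
      {for x, continuous (fun x => (a + 1) * w a (c + 1) x - (c + 1) * w (a + 1) c x)}.
    move=> /sub x01; apply: cvgB; apply: cvgM; try exact: cvg_cst;
      exact: continuous_jacobi_weight.
  have := FTC_is_derive ab dF cf; rewrite -/(inner_itv n) => /(congr1 fine).
  rewrite -EFinB /= -/(e n) => <-.
  rewrite -[RHS]/(\int[mu]_(x in inner_itv n) _).
  rewrite RintegralB; last 3 first.
  - exact: measurable_itv.
  - rewrite (_ : _ \o _ = fun x => ((a + 1)%:E * (w a (c + 1) x)%:E)%E).
      by apply: integrableZl => //; [exact: measurable_itv|apply: Iw; lra].
    by apply/funext => x /=; rewrite EFinM.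
  - rewrite (_ : _ \o _ = fun x => ((c + 1)%:E * (w (a + 1) c x)%:E)%E).
      by apply: integrableZl => //; [exact: measurable_itv|apply: Iw; lra].
    by apply/funext => x /=; rewrite EFinM.
  by rewrite !RintegralZl//; try exact: measurable_itv; apply: Iw; lra.
have L0 : (fun n => w (a + 1) (c + 1) (1 - e n) - w (a + 1) (c + 1) (e n)) @ \oo --> (0 : R).
  rewrite -(subr0 0); apply: cvgB.
    apply: (squeeze_cvgr _ (cvg_cst 0) (cvg_powR_inner q0)).
    apply: nearW => n; have [a0 ab] := inner_itv_bounds n.
    rewrite jacobi_weight_ge0/= /w (_ : 1 - (1 - e n) = e n); last by ring.
    rewrite ler_piMl ?powR_ge0// powR_le1 ?(ltW p0)// /e.
      by rewrite (lt_trans a0).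
    by rewrite gerBl ltW.
  apply: (squeeze_cvgr _ (cvg_cst 0) (cvg_powR_inner p0)).
  apply: nearW => n; have [a0 ab] := inner_itv_bounds n.
  rewrite jacobi_weight_ge0/= /w ler_piMr ?powR_ge0// powR_le1 ?(ltW q0)// /e.
    by rewrite (lt_trans a0).
  by rewrite gerBl ltW.
have L1 : (fun n => (a + 1) * I a (c + 1) n - (c + 1) * I (a + 1) c n) @ \oo -->
   (a + 1) * \int[mu]_(x in cc01) w a (c + 1) x -
   (c + 1) * \int[mu]_(x in cc01) w (a + 1) c x.
  apply: cvgB; apply: cvgM; try exact: cvg_cst; apply: cvg_fine_inner_itv; lra.
move: L1; under eq_fun do rewrite H; move=> L1.
by apply/eqP; rewrite -subr_eq0; apply/eqP; exact: (cvg_unique _ L1 L0).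
Qed.

End JacobiWeight.

(** * Univariate orthogonal polynomials *)

Section PolyIntegral.
Context {R : realType}.
Local Notation mu := (@lebesgue_measure R).
Local Notation w := (@jacobi_weight R).
Local Notation cc01 := (`[(0%R : R), (1%R : R)]%classic).
Implicit Types (a c : R) (p q : {poly R}).

Lemma measurable_horner p (D : set R) : measurable_fun D (horner p).
Proof.
elim/poly_ind: p => [|p k IH].
  by rewrite (_ : horner 0 = cst 0)//; apply/funext => x; rewrite horner0.
rewrite (_ : horner _ = fun x => p.[x] * x + k).
  by apply: measurable_funD => //; exact: measurable_funM.
by apply/funext => x; rewrite hornerMXaddC.
Qed.

Lemma integrable_poly a c p : -1 < a -> -1 < c ->
  mu.-integrable cc01 (fun x => (p.[x] * w a c x)%:E).
Proof.
move=> + c1; elim/poly_ind: p a => [|p k IH] a a1.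
  rewrite (_ : (fun _ => _) = cst 0%E); first exact: integrable0.
  by apply/funext => x; rewrite horner0 mul0r.
apply: (@eq_integrable _ _ _ mu _ _
    (fun x => ((p.[x] * w (a + 1) c x)%:E + k%:E * (w a c x)%:E)%E)) => //.
  move=> x; rewrite inE/= in_itv/= => /andP[x0 x1].
  by rewrite -EFinM -EFinD jacobi_weightDl// hornerMXaddC; congr EFin; ring.
apply: integrableD => //; first by apply: IH; lra.
by apply: integrableZl => //; exact: integrable_jacobi_weight.
Qed.

Lemma poly_in_L2 a c p : -1 < a -> -1 < c -> in_L2 `[0, 1] (w a c) (horner p).
Proof.
move=> a1 c1; split; first exact: measurable_horner.
have := integrable_poly (p ^+ 2) a1 c1; congr (mu.-integrable _ _).
by apply/funext => x; rewrite horner_exp.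
Qed.

Lemma jacobi_semi_ip a c : semi_ip (in_L2 `[0, 1] (w a c)) (jacobi_ip a c).
Proof.
apply: in_L2_semi_ip => //; first exact: measurable_jacobi_weightS.
by move=> x _; exact: jacobi_weight_ge0.
Qed.

Definition poly_int a c p : R := \int[mu]_(x in cc01) (p.[x] * w a c x).

Lemma jacobi_ip_poly a c p q :
  jacobi_ip a c (horner p) (horner q) = poly_int a c (p * q).
Proof. by apply: eq_Rintegral => x _; rewrite hornerM. Qed.

Lemma poly_intD a c p q k : -1 < a -> -1 < c ->
  poly_int a c (p + k *: q) = poly_int a c p + k * poly_int a c q.
Proof.
move=> a1 c1; rewrite /poly_int -RintegralZl//; last exact: integrable_poly.
rewrite -RintegralD//; last 2 first.
- exact: integrable_poly.
- rewrite (_ : _ \o _ = fun x => (k%:E * (q.[x] * w a c x)%:E)%E).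
    by apply: integrableZl => //; exact: integrable_poly.
  by apply/funext => x /=; rewrite EFinM.
by apply: eq_Rintegral => x _; rewrite hornerD hornerZ; ring.
Qed.

Lemma poly_intC a c k : -1 < a -> -1 < c ->
  poly_int a c k%:P = k * \int[mu]_(x in cc01) w a c x.
Proof.
move=> a1 c1; rewrite -RintegralZl//; last exact: integrable_jacobi_weight.
by apply: eq_Rintegral => x _; rewrite hornerC.
Qed.

Lemma poly_intXl a c p : -1 < a -> poly_int a c ('X * p) = poly_int (a + 1) c p.
Proof.
move=> a1; apply: eq_Rintegral => x; rewrite inE/= in_itv/= => /andP[x0 _].
by rewrite jacobi_weightDl// hornerM hornerX; ring.
Qed.

Lemma poly_intXr a c p : -1 < c ->
  poly_int a c ((1 - 'X) * p) = poly_int a (c + 1) p.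
Proof.
move=> a1; apply: eq_Rintegral => x; rewrite inE/= in_itv/= => /andP[_ x1].
by rewrite jacobi_weightDr// hornerM hornerD hornerN hornerX -polyC1 hornerC; ring.
Qed.

Lemma poly_int_ge0 a c p : 0 <= poly_int a c (p * p).
Proof.
apply: Rintegral_ge0 => x _.
by rewrite hornerM mulr_ge0 ?jacobi_weight_ge0// -expr2 sqr_ge0.
Qed.

(** Integration by parts for the weight with both exponents raised, so that
    there is no boundary term. A factor X is absorbed into the weight by
    raising a, which reduces the claim by induction to the constants, where it
    is jacobi_weight_by_parts. *)
Lemma poly_int_deriv a c p : -1 < a -> -1 < c ->
  poly_int (a + 1) (c + 1) p^`() =
  poly_int a c (p * ((c + 1) *: 'X - (a + 1) *: (1 - 'X))).
Proof.
move=> + c1; elim/poly_ind: p a => [|p k IH] a a1.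
  have c2 : -1 < c + 1 by lra.
  have a2 : -1 < a + 1 by lra.
  by rewrite deriv0 mul0r -(polyC0 R) !poly_intC// !mul0r.
have a2 : -1 < a + 1 by lra.
have c2 : -1 < c + 1 by lra.
rewrite derivD derivM derivX derivC addr0 mulr1.
have -> : p^`() * 'X + p = 'X * p^`() + 1 *: p by rewrite scale1r mulrC.
rewrite poly_intD// poly_intXl// IH// mul1r.
rewrite -(poly_intXr _ _ c1).
have -> : (p * 'X + k%:P) * ((c + 1) *: 'X - (a + 1) *: (1 - 'X)) =
   'X * (p * ((c + 1) *: 'X - (a + 1 + 1) *: (1 - 'X)) + 1 *: ((1 - 'X) * p))
   + k *: ((c + 1) *: ('X * 1) + (- (a + 1)) *: ((1 - 'X) * 1)).
  by rewrite -!mul_polyC !(polyCD, polyCN, polyC1); ring.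
rewrite [RHS]poly_intD// poly_intXl// poly_intD// mul1r.
suff -> : poly_int a c ((c + 1) *: ('X * 1) + (- (a + 1)) *: ((1 - 'X) * 1)) = 0.
  by rewrite mulr0 addr0.
rewrite -[X in poly_int _ _ (X + _)]add0r !poly_intD// poly_intXl// poly_intXr//.
rewrite -(polyC0 R) -(polyC1 R) !poly_intC// mul0r !mul1r add0r mulNr.
by rewrite -jacobi_weight_by_parts// subrr.
Qed.

End PolyIntegral.

Section Monic.
Context {R : realType}.
Local Notation w := (@jacobi_weight R).
Implicit Types (a c : R) (p q D M N : {poly R}).

Lemma poly1_lin_closed n : lin_closed (@poly1_le R n).
Proof.
split; first by exists 0 => [|x]; rewrite ?size_poly0 ?horner0.
move=> a f g [p sp fp] [q sq gq]; exists (p + a *: q).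
  by rewrite (leq_trans (size_polyD _ _))// geq_max sp (leq_trans (size_scale_leq _ _)).
by move=> x; rewrite fp gq hornerD hornerZ.
Qed.

Lemma poly1_le_horner n p : (size p <= n.+1)%N -> poly1_le n (horner p).
Proof. by exists p. Qed.

Lemma poly1_leP n (g : R -> R) :
  poly1_le n g -> exists2 p : {poly R}, (size p <= n.+1)%N & g = horner p.
Proof. by move=> [p sp gp]; exists p => //; apply/funext. Qed.

Lemma poly1_sub_L2 a c n : -1 < a -> -1 < c ->
  @poly1_le R n `<=` in_L2 `[0, 1] (w a c).
Proof. by move=> a1 c1 _ /poly1_leP[p _ ->]; exact: poly_in_L2. Qed.

Lemma poly1_projectable a c n f : -1 < a -> -1 < c ->
  in_L2 `[0, 1] (w a c) f -> projectable (jacobi_ip a c) (poly1_le n) f.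
Proof.
move=> a1 c1 Lf.
apply: (fin_projectable (jacobi_semi_ip a c) (s := index_enum 'I_n.+1)
   (e := fun i => horner 'X^i)) => //.
- exact: poly1_lin_closed.
- exact: poly1_sub_L2.
- by move=> i; apply: poly1_le_horner; rewrite size_polyXn ltn_ord.
- move=> _ /poly1_leP[p sp ->]; exists (fun i : 'I_n.+1 => p`_i); apply/funext => x.
  rewrite (horner_coef_wide _ sp); apply: eq_bigr => i _.
  by rewrite /= hornerXn.
Qed.

Definition monic_orth a c n M := [/\ M \is monic, size M = n.+1 &
  forall q, (size q <= n)%N -> poly_int a c (M * q) = 0].

Lemma exists_monic_orth a c n : -1 < a -> -1 < c -> exists M, monic_orth a c n M.
Proof.
move=> a1 c1; case: n => [|n].
  exists 1; split; rewrite ?monic1 ?size_poly1// => q.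
  by rewrite leqn0 size_poly_eq0 => /eqP ->; rewrite mulr0 -(polyC0 R) poly_intC// mul0r.
have [_ /poly1_leP[q sq ->] qP] := poly1_projectable n a1 c1 (poly_in_L2 'X^(n.+1) a1 c1).
have sqn : (size (- q) < size ('X^(n.+1) : {poly R}))%N by rewrite size_polyN size_polyXn.
have sM : size ('X^(n.+1) - q) = n.+2 by rewrite size_polyDl// size_polyXn.
exists ('X^(n.+1) - q); split => //.
  by rewrite monicE lead_coefDl// lead_coefXn.
move=> r sr; rewrite -jacobi_ip_poly.
rewrite -(qP _ (poly1_le_horner sr)); congr jacobi_ip.
by apply/funext => x; rewrite hornerD hornerN.
Qed.

(** M has the least norm among the monic polynomials of its degree: D is a
    multiple of M plus a polynomial of lower degree, which is orthogonal to M. *)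
Lemma poly_int_monic_le a c n M D : -1 < a -> -1 < c -> monic_orth a c n M ->
  (size D <= n.+1)%N -> D`_n ^+ 2 * poly_int a c (M * M) <= poly_int a c (D * D).
Proof.
move=> a1 c1 [mM sM oM] sD; set d := D`_n.
pose q := D - d *: M.
have sq : (size q <= n)%N.
  apply/leq_sizeP => j; rewrite leq_eqVlt => /predU1P[<-|nj].
    by rewrite coefB coefZ -/d; move: mM; rewrite monicE lead_coefE sM => /eqP ->; ring.
  rewrite coefB coefZ !nth_default ?mulr0 ?subrr//; first by rewrite sM.
  exact: leq_trans sD nj.
have -> : D * D = q * q + (2 * d) *: (M * q) + (d ^+ 2) *: (M * M).
  rewrite /q -!mul_polyC !rmorphM /=.
  rewrite (_ : 2%:P = 2 :> {poly R}); last by rewrite rmorph_nat.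
  by ring.
by rewrite !poly_intD// (oM _ sq) mulr0 addr0 lerDr poly_int_ge0.
Qed.

Lemma monic_orth_eq a c n M N : -1 < a -> -1 < c ->
  monic_orth a c n M -> monic_orth a c n N ->
  poly_int a c (M * M) = poly_int a c (N * N).
Proof.
move=> a1 c1; wlog suff : M N / monic_orth a c n M -> monic_orth a c n N ->
    poly_int a c (M * M) <= poly_int a c (N * N).
  by move=> H HM HN; apply/eqP; rewrite eq_le !H.
move=> HM [mN sN _]; have := poly_int_monic_le a1 c1 HM (D := N).
rewrite sN => /(_ (leqnn _)).
by move: mN; rewrite monicE lead_coefE sN => /eqP ->; rewrite expr1n mul1r.
Qed.

(** Integration by parts moves the derivative of M onto q times the weight,
    which turns q into a polynomial of degree one more; the leading coefficient
    of the latter is that of q times a + c + 2 + deg q. *)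
Lemma poly_int_deriv_mul a c M q : -1 < a -> -1 < c ->
  poly_int (a + 1) (c + 1) (M^`() * q) = poly_int a c
    (M * (q * ((c + 1) *: 'X - (a + 1) *: (1 - 'X)) - 'X * (1 - 'X) * q^`())).
Proof.
move=> a1 c1; have a2 : -1 < a + 1 by lra.
have c2 : -1 < c + 1 by lra.
have := poly_int_deriv (M * q) a1 c1; rewrite derivM => E.
have -> : M^`() * q = (M^`() * q + M * q^`()) + (-1) *: (M * q^`()).
  by rewrite scaleN1r addrK.
rewrite poly_intD// E mulN1r -poly_intXr// -poly_intXl// -mulN1r.
rewrite -poly_intD//; congr poly_int.
by rewrite scaleN1r; ring.
Qed.

Lemma size_deriv_dual a c q n : (size q <= n)%N ->
  (size (q * ((c + 1) *: 'X - (a + 1) *: (1 - 'X)) - 'X * (1 - 'X) * q^`())%R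
    <= n.+1)%N.
Proof.
move=> sq; have s2 (r s : {poly R}) k l : (size r <= k)%N -> (size s <= l.+1)%N ->
    (size (r * s)%R <= k + l)%N.
  move=> rk sl; rewrite (leq_trans (size_polyMleq _ _))//.
  by move: (leq_add rk sl); rewrite addnS; case: (size r + size s)%N.
have sX1 : (size (1 - 'X : {poly R})%R <= 2)%N.
  by rewrite (leq_trans (size_polyD _ _))// geq_max size_poly1 size_polyN size_polyX.
rewrite (leq_trans (size_polyD _ _))// geq_max size_polyN -addn1; apply/andP; split.
  apply: s2 => //; rewrite (leq_trans (size_polyD _ _))// geq_max size_polyN.
  by rewrite !(leq_trans (size_scale_leq _ _))// size_polyX.
case: n sq => [|n] sq.
  by move: sq; rewrite leqn0 size_poly_eq0 => /eqP ->; rewrite deriv0 mulr0 size_poly0.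
rewrite mulrC addSnnS; apply: (s2 _ _ _ 2); last by apply: (s2 _ _ 2 1); rewrite ?size_polyX.
have [->|q0] := eqVneq q 0; first by rewrite deriv0 size_poly0.
by rewrite -ltnS (leq_trans (lt_size_deriv q0)).
Qed.

Lemma coef_deriv_dual a c q n : (size q <= n.+1)%N ->
  (q * ((c + 1) *: 'X - (a + 1) *: (1 - 'X)) - 'X * (1 - 'X) * q^`())`_n.+1 =
  (n%:R + a + c + 2) * q`_n.
Proof.
move=> sq; have qS : q`_n.+1 = 0 by rewrite nth_default.
have -> : q * ((c + 1) *: 'X - (a + 1) *: (1 - 'X)) - 'X * (1 - 'X) * q^`() =
    (a + c + 2) *: (q * 'X) - (a + 1) *: q - q^`() * 'X + q^`() * 'X * 'X.
  by rewrite -!mul_polyC !polyCD polyC1; ring.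
rewrite !coefD !coefN !coefZ !coefMX /= !coef_deriv qS.
case: n {sq qS} => [|n] /=; first by ring.
by rewrite -natr1; ring.
Qed.

Lemma monic_deriv n M : M \is monic -> size M = n.+2 ->
  n.+1%:R^-1 *: M^`() \is monic /\ size (n.+1%:R^-1 *: M^`()) = n.+1.
Proof.
move=> mM sM; have n0 : n.+1%:R != 0 :> R by rewrite pnatr_eq0.
have M0 : M != 0 by rewrite -size_poly_eq0 sM.
have cM : M^`()`_n = n.+1%:R.
  by move: mM; rewrite monicE lead_coefE sM coef_deriv => /eqP ->.
have sM' : size M^`() = n.+1.
  apply/eqP; rewrite eqn_leq -ltnS -sM lt_size_deriv//= ltnNge.
  by apply: contra_neqN n0 => /leq_sizeP h; rewrite -cM h.
rewrite size_scale ?invr_eq0// monicE lead_coefZ lead_coefE sM' cM.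
by rewrite mulVf.
Qed.

(** By poly_int_deriv_mul, testing M' against q is testing M against a polynomial
    of degree at most deg q + 1. *)
Lemma monic_orth_deriv a c n M : -1 < a -> -1 < c ->
  monic_orth a c n.+1 M -> monic_orth (a + 1) (c + 1) n (n.+1%:R^-1 *: M^`()).
Proof.
move=> a1 c1 [mM sM oM]; have [mM' sM'] := monic_deriv mM sM.
have a2 : -1 < a + 1 by lra.
have c2 : -1 < c + 1 by lra.
split=> // q sq; rewrite -scalerAl -[X in poly_int _ _ X]add0r poly_intD//.
rewrite poly_int_deriv_mul// oM ?mulr0 ?addr0; last exact: size_deriv_dual.
by rewrite -(polyC0 R) poly_intC ?mul0r.
Qed.

(** By monic_orth_deriv, N is M' up to the factor n + 1. Integrating by parts the
    product of M' and N leaves the product of M and a polynomial of degree n + 1,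
    of which only the leading coefficient n + a + c + 2 counts. *)
Lemma monic_norm_deriv a c n M N : -1 < a -> -1 < c ->
  monic_orth a c n.+1 M -> monic_orth (a + 1) (c + 1) n N ->
  (n%:R + a + c + 2) * poly_int a c (M * M) =
  n.+1%:R * poly_int (a + 1) (c + 1) (N * N).
Proof.
move=> a1 c1 HM HN; have [mM sM oM] := HM.
have a2 : -1 < a + 1 by lra.
have c2 : -1 < c + 1 by lra.
have HN' := monic_orth_deriv a1 c1 HM.
rewrite (monic_orth_eq a2 c2 HN HN'); set q := _ *: M^`().
have [mq sq] : q \is monic /\ size q = n.+1 by exact: monic_deriv.
have q1 : q`_n = 1 by move: mq; rewrite monicE lead_coefE sq => /eqP.
have M1 : M`_n.+1 = 1 by move: mM; rewrite monicE lead_coefE sM => /eqP.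
have -> : q * q = 0 + n.+1%:R^-1 *: (M^`() * q) by rewrite add0r -scalerAl.
rewrite poly_intD// -(polyC0 R) poly_intC// mul0r add0r mulrA mulfV ?pnatr_eq0// mul1r.
rewrite poly_int_deriv_mul//; set T := _ - _.
have sT : (size T <= n.+2)%N by apply: size_deriv_dual; rewrite sq.
have cT : T`_n.+1 = n%:R + a + c + 2 by rewrite coef_deriv_dual ?sq// q1 mulr1.
set k := n%:R + a + c + 2 in cT *.
have -> : M * T = M * (T - k *: M) + k *: (M * M).
  by rewrite [M * (T - _)]mulrBr -scalerAr subrK.
rewrite poly_intD// (oM (T - k *: M)) ?add0r//.
apply/leq_sizeP => j; rewrite leq_eqVlt => /predU1P[<-|nj].
  by rewrite coefB coefZ cT M1; ring.
by rewrite coefB coefZ !nth_default ?mulr0 ?subrr ?sM// (leq_trans sT).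
Qed.

(** For n = 0 this is jacobi_weight_by_parts. The factors in monic_norm_deriv
    depend on n and the sum of the exponents only, so that they are the same for M
    and N, and the ratio for degree n at (a + 1, c + 1) is the one required for
    degree n + 1 at (a, c). *)
Lemma monic_norm_shift a c n M N : -1 < a -> -1 < c ->
  monic_orth a (c + 1) n M -> monic_orth (a + 1) c n N ->
  (a + 1 + n%:R) * poly_int a (c + 1) (M * M) =
  (c + 1 + n%:R) * poly_int (a + 1) c (N * N).
Proof.
elim: n a c M N => [|n IH] a c M N a1 c1 HM HN.
  have M1 P a' c' : monic_orth a' c' 0 P -> P = 1.
    move=> [mP sP _]; have /size_poly1P[k k0 E] : size P == 1%N by rewrite sP.
    by move: mP; rewrite E monicE lead_coefC => /eqP ->.
  rewrite (M1 _ _ _ HM) (M1 _ _ _ HN) mulr1 !addr0 -polyC1 !poly_intC; [|lra..].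
  by rewrite !mul1r jacobi_weight_by_parts.
have a2 : -1 < a + 1 by lra.
have c2 : -1 < c + 1 by lra.
have a3 : -1 < a + 1 + 1 by lra.
have c3 : -1 < c + 1 + 1 by lra.
have [K HK] := exists_monic_orth n a2 c3.
have [L HL] := exists_monic_orth n a3 c2.
have := IH _ _ _ _ a2 c2 HK HL.
have := monic_norm_deriv a1 c2 HM HK; have := monic_norm_deriv a2 c1 HN HL.
have n0 : n%:R + a + c + 1 + 2 != 0 :> R.
  by have : 0 <= n%:R :> R by []; move=> ?; rewrite gt_eqF//; lra.
move: (poly_int _ _ (M * M)) (poly_int _ _ (N * N)) (poly_int _ _ (K * K))
  (poly_int _ _ (L * L)) => m n' k l En Em E.
apply: (mulfI n0).
rewrite -[n.+1%:R]natr1.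
have -> : (n%:R + a + c + 1 + 2) * ((a + 1 + (n%:R + 1)) * m) =
   (a + 1 + (n%:R + 1)) * ((n%:R + a + (c + 1) + 2) * m) by ring.
rewrite Em mulrCA.
have -> : a + 1 + (n%:R + 1) = a + 1 + 1 + n%:R by ring.
rewrite E mulrCA -En; ring.
Qed.

Lemma monic_norm_gt0 a c n M : -1 < a -> -1 < c ->
  monic_orth a c n M -> 0 < poly_int a c (M * M).
Proof.
elim: n a c M => [|n IH] a c M a1 c1 HM.
  have [mM sM _] := HM; have /size_poly1P[k k0 E] : size M == 1%N by rewrite sM.
  move: mM; rewrite E monicE lead_coefC => /eqP ->.
  by rewrite mulr1 poly_intC// mul1r integral_jacobi_weight_gt0.
have a2 : -1 < a + 1 by lra.
have c2 : -1 < c + 1 by lra.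
have [N HN] := exists_monic_orth n a2 c2.
have n0 : 0 < n%:R + a + c + 2 :> R.
  by have : 0 <= n%:R :> R by []; move=> ?; lra.
rewrite -(pmulr_rgt0 _ n0) (monic_norm_deriv a1 c1 HM HN).
by rewrite mulr_gt0// IH.
Qed.

(** The norm of p is at least that of the monic orthogonal polynomial of the same
    degree, scaled by the leading coefficient of p. *)
Lemma poly_int_definite a c p : -1 < a -> -1 < c -> poly_int a c (p * p) = 0 ->
  p = 0.
Proof.
move=> a1 c1 p0; apply/eqP/negPn/negP => pn0.
have [M HM] := exists_monic_orth (size p).-1 a1 c1.
have sp : (size p <= (size p).-1.+1)%N by exact: leqSpred.
have := poly_int_monic_le a1 c1 HM sp.
rewrite p0 -lead_coefE leNgt mulr_gt0 ?(monic_norm_gt0 a1 c1 HM)//.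
by rewrite lt_neqAle sqr_ge0 eq_sym sqrf_eq0 lead_coef_eq0 pn0.
Qed.

(** Let Q be X - 1 times the monic orthogonal polynomial N of degree k for the
    weight w a (c + 2). Subtracting a multiple of Q removes the leading term of D
    without changing D(1). The multiple is controlled because the norm of Q for
    w a c, which is that of N for w a (c + 2), exceeds the norm of the monic
    orthogonal polynomial M of degree k + 1, and hence that of D divided by its
    leading coefficient, by a bounded factor only. *)
Lemma degree_reduction a c : -1 < a -> -1 < c ->
  exists2 C : R, 0 < C & forall k D, (size D <= k.+2)%N ->
    exists2 r : {poly R}, (size r <= k.+1)%N & r.[1] = D.[1] /\
      jacobi_norm a c (horner r) <= C * jacobi_norm a c (horner D).
Proof.
move=> a1 c1.
have a2 : -1 < a + 1 by lra.
have c2 : -1 < c + 1 by lra.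
have c3 : -1 < c + 1 + 1 by lra.
(* B bounds for all k the ratio of the squared norms of N and M, which is a product
   of two explicit fractions by monic_norm_shift and monic_norm_deriv. *)
pose B := (1 + (c + 2) / (a + 1)) * (a + c + 3).
have B0 : 0 <= B.
  have : 0 <= (c + 2) / (a + 1) by rewrite divr_ge0//; lra.
  by move=> ?; rewrite mulr_ge0//; lra.
exists (1 + Num.sqrt B) => [|k D sD]; first by rewrite ltr_pwDl ?sqrtr_ge0.
have [M HM] := exists_monic_orth k.+1 a1 c1.
have [N HN] := exists_monic_orth k a1 c3.
have [K HK] := exists_monic_orth k a2 c2.
have [mN sN _] := HN.
pose d := D`_k.+1.
pose Q := ('X - 1) * N.
have E : d ^+ 2 * poly_int a c (Q * Q) <= B * poly_int a c (D * D).
  have -> : Q * Q = (1 - 'X) * ((1 - 'X) * (N * N)) by rewrite /Q; ring.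
  rewrite !poly_intXr//.
  have h1 := poly_int_monic_le a1 c1 HM sD; rewrite -/d in h1.
  have h2 := monic_norm_deriv a1 c1 HM HK.
  have h3 := monic_norm_shift a1 c2 HN HK.
  have m0 := monic_norm_gt0 a1 c1 HM.
  move: (poly_int _ _ (M * M)) (poly_int _ _ (N * N)) (poly_int _ _ (K * K))
    (poly_int _ _ (D * D)) m0 h1 h2 h3 => m nu kp JD m0 h1 h2 h3.
  apply: (@le_trans _ _ (B * (d ^+ 2 * m))); last by rewrite ler_wpM2l.
  rewrite mulrCA ler_wpM2l ?sqr_ge0//.
  have k0 : 0 <= k%:R :> R by [].
  rewrite -[k.+1%:R]natr1 in h2; move: (k%:R) k0 h2 h3 => t t0 h2 h3.
  have -> : nu = ((c + 1 + 1 + t) / (a + 1 + t)) * ((t + a + c + 2) / (t + 1)) * m.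
    have x0 : a + 1 + t != 0 by rewrite gt_eqF//; lra.
    have y0 : t + 1 != 0 by rewrite gt_eqF//; lra.
    have -> : nu = (a + 1 + t) * nu / (a + 1 + t) by field.
    rewrite h3.
    have -> : kp = (t + 1) * kp / (t + 1) by field.
    by rewrite -h2; field; rewrite y0 x0.
  rewrite ler_wpM2r ?(ltW m0)// /B ler_pM//.
  - by rewrite divr_ge0//; lra.
  - by rewrite divr_ge0//; lra.
  - rewrite ler_pdivrMr; last by lra.
    rewrite mulrDl mul1r.
    have : (c + 2) <= (c + 2) / (a + 1) * (a + 1 + t).
      rewrite mulrAC ler_pdivlMr; last by lra.
      by rewrite ler_wpM2l//; lra.
    by lra.
  - by rewrite ler_pdivrMr; nra.
have Q1 : Q`_k.+1 = 1.
  rewrite /Q mulrBl mul1r mulrC coefB coefMX /= [N`_k.+1]nth_default ?sN// subr0.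
  by move: mN; rewrite monicE lead_coefE sN => /eqP.
have sQ : (size Q <= k.+2)%N.
  rewrite (leq_trans (size_polyMleq _ _))// sN.
  by rewrite size_XsubC.
exists (D - d *: Q); first last.
  split.
    rewrite /Q -polyC1 hornerD hornerN hornerZ hornerM hornerXsubC subrr mul0r.
    by rewrite mulr0 subr0.
  rewrite mulrDl mul1r.
  have -> : horner (D - d *: Q) = horner D \+ horner (- d *: Q).
    by apply/funext => x /=; rewrite scaleNr hornerD.
  have := sip_triangle (jacobi_semi_ip a c) (poly_in_L2 D a1 c1)
    (poly_in_L2 (- d *: Q) a1 c1).
  move=> /le_trans; apply; rewrite lerD2l -sqrtrM// ler_wsqrtr// !jacobi_ip_poly.
  apply: le_trans E; rewrite -scalerAl -scalerAr scalerA mulrNN -expr2.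
  by rewrite -[X in poly_int _ _ X]add0r poly_intD// -(polyC0 R) poly_intC// mul0r add0r.
apply/leq_sizeP => j; rewrite leq_eqVlt => /predU1P[<-|nj].
  by rewrite coefB coefZ Q1 -/d; ring.
by rewrite coefB coefZ !nth_default ?mulr0 ?subrr// ?(leq_trans sD) ?(leq_trans sQ).
Qed.

End Monic.

(** * Bivariate polynomials and projections on the wedge *)

Section Poly2.
Context {R : realType}.
Implicit Types (f g : R * R -> R).

Lemma lin_closed_sum (T I : Type) (V : set (T -> R)) (s : seq I) (P : pred I)
    (a : I -> R) (e : I -> T -> R) :
  lin_closed V -> (forall i, P i -> V (e i)) ->
  V (fun x => \sum_(i <- s | P i) a i * e i x).
Proof.
move=> [V0 Vl] Ve; elim: s => [|i s IH].
  by rewrite (_ : (fun x => _) = fun=> 0)//; apply/funext => x; rewrite big_nil.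
have [Pi|Pi] := boolP (P i); last first.
  rewrite (_ : (fun x => _) = fun x => \sum_(i <- s | P i) a i * e i x)//.
  by apply/funext => x; rewrite big_cons (negbTE Pi).
rewrite (_ : (fun x => _) = fun x => \sum_(i <- s | P i) a i * e i x + a i * e i x).
  by apply: Vl => //; exact: Ve.
by apply/funext => x; rewrite big_cons Pi addrC.
Qed.

Definition monomial i j : R * R -> R := fun p => p.1 ^+ i * p.2 ^+ j.

Lemma poly2_lin_closed n : lin_closed (@poly2_le R n).
Proof.
split.
  by exists (fun _ _ => 0) => x y; rewrite big1// => i _; rewrite big1// => j _; ring.
move=> a f g [c fc] [d gd]; exists (fun i j => c i j + a * d i j) => x y.
rewrite fc gd mulr_sumr -big_split; apply: eq_bigr => i _ /=.
rewrite mulr_sumr -big_split; apply: eq_bigr => j _ /=; ring.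
Qed.

Lemma poly2_monomial n i j : (i + j <= n)%N -> poly2_le n (monomial i j).
Proof.
move=> ijn; exists (fun i' j' => ((i' == i) && (j' == j))%:R) => x y.
have li : (i < n.+1)%N by rewrite ltnS (leq_trans (leq_addr _ _) ijn).
have lj : (j < n.+1)%N by rewrite ltnS (leq_trans (leq_addl _ _) ijn).
rewrite (bigD1 (Ordinal li))//= [X in _ + X]big1 ?addr0; last first.
  move=> i' /negP ii'; rewrite big1// => j' _.
  have /negbTE -> : (i' : nat) != i by apply/negP => /eqP E; apply: ii'; apply/eqP/val_inj.
  by rewrite !mul0r.
rewrite (bigD1 (Ordinal lj))//= big1 ?addr0; last first.
  move=> j' /andP[_ /negP jj'].
  have /negbTE -> : (j' : nat) != j by apply/negP => /eqP E; apply: jj'; apply/eqP/val_inj.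
  by rewrite andbF !mul0r.
by rewrite !eqxx mul1r.
Qed.

(** Stated for closed sets of functions, so that a property stable under linear
    combinations needs only be checked on monomials. *)
Lemma poly2_ind n (P : set (R * R -> R)) : lin_closed P ->
  (forall i j, (i + j <= n)%N -> P (monomial i j)) -> poly2_le n `<=` P.
Proof.
move=> Pl Pm g [c gc].
rewrite (_ : g = fun p => \sum_(i < n.+1) 1 *
   (\sum_(j < n.+1 | (i + j <= n)%N) c i j * monomial i j p)).
  apply: (@lin_closed_sum _ _ P _ predT (fun _ => 1) (fun (i : 'I_n.+1) p =>
    \sum_(j < n.+1 | (i + j <= n)%N) c i j * monomial i j p)) => // i _.
  apply: (@lin_closed_sum _ _ P _ (fun j : 'I_n.+1 => (i + j <= n)%N)
    (fun j => c i j) (fun j => monomial i j)) => // j.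
  exact: Pm.
apply/funext => -[x y]; rewrite gc; apply: eq_bigr => i _; rewrite mul1r.
by apply: eq_bigr => j _; rewrite mulrA.
Qed.

Lemma poly2_span n g : poly2_le n g -> exists c : 'I_n.+1 * 'I_n.+1 -> R,
  g = fun p => \sum_(k : 'I_n.+1 * 'I_n.+1) c k *
    (if (k.1 + k.2 <= n)%N then monomial k.1 k.2 p else 0).
Proof.
move=> [c gc]; exists (fun k : 'I_n.+1 * 'I_n.+1 => c k.1 k.2); apply/funext => -[x y]; rewrite gc.
rewrite -(pair_bigA _ (fun i j : 'I_n.+1 =>
   c i j * (if (i + j <= n)%N then monomial i j (x, y) else 0))) /=.
apply: eq_bigr => i _; rewrite big_mkcond; apply: eq_bigr => j _.
by case: ifP => _; rewrite ?mulr0// mulrA.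
Qed.

Lemma poly2_fst n (p : {poly R}) : (size p <= n.+1)%N ->
  poly2_le n (fun z => p.[z.1]).
Proof.
move=> sp; rewrite (_ : (fun z => _) =
  fun z => \sum_(i < n.+1) p`_i * monomial i 0 z).
  apply: (@lin_closed_sum _ _ (poly2_le n) _ predT (fun i : 'I_n.+1 => p`_i)
    (fun i => monomial i 0)) => [|i _].
    exact: poly2_lin_closed.
  by apply: poly2_monomial; rewrite addn0 -ltnS.
apply/funext => z; rewrite (horner_coef_wide _ sp); apply: eq_bigr => i _.
by rewrite /monomial mulr1.
Qed.

Lemma poly2_snd n (p : {poly R}) : (size p <= n.+1)%N ->
  poly2_le n (fun z => p.[z.2]).
Proof.
move=> sp; rewrite (_ : (fun z => _) =
  fun z => \sum_(i < n.+1) p`_i * monomial 0 i z).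
  apply: (@lin_closed_sum _ _ (poly2_le n) _ predT (fun i : 'I_n.+1 => p`_i)
    (fun i => monomial 0 i)) => [|i _].
    exact: poly2_lin_closed.
  by apply: poly2_monomial; rewrite add0n -ltnS.
apply/funext => z; rewrite (horner_coef_wide _ sp); apply: eq_bigr => i _.
by rewrite /monomial mul1r.
Qed.

Lemma poly2_edge1 n g s : poly2_le n g -> poly1_le n (fun x => g (x, s)).
Proof.
apply: (poly2_ind (P := [set g | poly1_le n (fun x => g (x, s))])).
  by have [V0 Vl] := @poly1_lin_closed R n; split => // a f h; exact: Vl.
move=> i j ijn; exists (s ^+ j *: 'X^i) => [|x].
  rewrite (leq_trans (size_scale_leq _ _))// size_polyXn ltnS.
  exact: leq_trans (leq_addr _ _) ijn.
by rewrite /monomial/= hornerZ hornerXn mulrC.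
Qed.

Lemma poly2_edge2 n g s : poly2_le n g -> poly1_le n (fun y => g (s, y)).
Proof.
apply: (poly2_ind (P := [set g | poly1_le n (fun x => g (s, x))])).
  by have [V0 Vl] := @poly1_lin_closed R n; split => // a f h; exact: Vl.
move=> i j ijn; exists (s ^+ i *: 'X^j) => [|x].
  rewrite (leq_trans (size_scale_leq _ _))// size_polyXn ltnS.
  exact: leq_trans (leq_addl _ _) ijn.
by rewrite /monomial/= hornerZ hornerXn.
Qed.

End Poly2.

Section Wedge.
Context {R : realType}.
Local Notation w := (@jacobi_weight R).
Variables alpha beta gamma : R.
Hypotheses (alpha_gt : -1 < alpha) (beta_gt : -1 < beta) (gamma_gt : -1 < gamma).
Implicit Types (f g : R * R -> R).

Lemma jacobi_const_gt0 a c : -1 < a -> -1 < c -> 0 < jacobi_const a c :> R.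
Proof. by move=> a1 c1; rewrite invr_gt0 integral_jacobi_weight_gt0. Qed.

Lemma shift_gt (a : R) (d : bool) : -1 < a -> -1 < a + d%:R.
Proof. by case: d => /=; lra. Qed.

Definition wedge_L2 (d1 d2 : bool) : set (R * R -> R) :=
  (fun f x => f (x, 1)) @^-1` in_L2 `[0, 1] (w (alpha + d1%:R) gamma) `&`
  (fun f y => f (1, y)) @^-1` in_L2 `[0, 1] (w (beta + d2%:R) gamma).

Lemma wedge_sigma_gt0 d1 d2 : 0 < wedge_sigma alpha beta gamma d1 d2.
Proof. by rewrite divr_gt0// mulr_gt0// jacobi_const_gt0// shift_gt. Qed.

Lemma wedge_semi_ip d1 d2 :
  semi_ip (wedge_L2 d1 d2) (wedge_ip alpha beta gamma d1 d2).
Proof.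
have A0 := jacobi_const_gt0 (shift_gt d1 alpha_gt) gamma_gt.
have B0 := mulr_gt0 (wedge_sigma_gt0 d1 d2)
  (jacobi_const_gt0 (shift_gt d2 beta_gt) gamma_gt).
apply: (semi_ip_comb (ltW A0) (ltW B0)).
  exact: (semi_ip_pullback (phi := fun f x => f (x, 1)) _ (jacobi_semi_ip _ _)).
exact: (semi_ip_pullback (phi := fun f x => f (1, x)) _ (jacobi_semi_ip _ _)).
Qed.

Lemma poly2_sub_wedge_L2 d1 d2 n : poly2_le n `<=` wedge_L2 d1 d2.
Proof.
move=> g Vg; split.
  by apply: poly1_sub_L2 (poly2_edge1 1 Vg) => //; exact: shift_gt.
by apply: poly1_sub_L2 (poly2_edge2 1 Vg) => //; exact: shift_gt.
Qed.

Lemma wedge_projectable d1 d2 n f : wedge_L2 d1 d2 f ->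
  projectable (wedge_ip alpha beta gamma d1 d2) (poly2_le n) f.
Proof.
move=> Wf; apply: (fin_projectable (wedge_semi_ip d1 d2)
  (s := index_enum ('I_n.+1 * 'I_n.+1)%type)
  (e := fun k p => if (k.1 + k.2 <= n)%N then monomial k.1 k.2 p else 0)) => //.
- exact: poly2_lin_closed.
- exact: poly2_sub_wedge_L2.
- move=> [i j] /=; have [ijn|_] := boolP (i + j <= n)%N; last exact: (poly2_lin_closed n).1.
  exact: poly2_monomial.
- exact: poly2_span.
Qed.

Lemma wedge_projP d1 d2 n f : wedge_L2 d1 d2 f ->
  poly2_le n (wedge_proj alpha beta gamma d1 d2 n f) /\
  forall q, poly2_le n q -> wedge_ip alpha beta gamma d1 d2
    (f \- wedge_proj alpha beta gamma d1 d2 n f) q = 0.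
Proof. by move=> Wf; apply: orth_projP; exact: wedge_projectable. Qed.

(** The restrictions to the two edges are polynomials of norm 0, hence 0. This is
    what makes partial sums on the wedge unique as functions on the wedge. *)
Lemma wedge_definite d1 d2 n g : poly2_le n g ->
  wedge_ip alpha beta gamma d1 d2 g g = 0 ->
  forall x, g (x, 1) = 0 /\ g (1, x) = 0.
Proof.
move=> Vg.
have [p _ gp] := poly2_edge1 1 Vg; have [q _ gq] := poly2_edge2 1 Vg.
have a1 := shift_gt d1 alpha_gt; have b1 := shift_gt d2 beta_gt.
rewrite /wedge_ip (_ : Rintegral _ _ _ = poly_int (alpha + d1%:R) gamma (p * p)); last first.
  by apply: eq_Rintegral => x _; rewrite hornerM !gp.
rewrite (_ : Rintegral _ _ (fun y => _ * jacobi_weight (beta + _) _ _) =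
   poly_int (beta + d2%:R) gamma (q * q)); last first.
  by apply: eq_Rintegral => x _; rewrite hornerM !gq.
have A0 := jacobi_const_gt0 a1 gamma_gt.
have B0 := mulr_gt0 (wedge_sigma_gt0 d1 d2) (jacobi_const_gt0 b1 gamma_gt).
have P0 := poly_int_ge0 (alpha + d1%:R) gamma p.
have Q0 := poly_int_ge0 (beta + d2%:R) gamma q.
move=> /eqP; rewrite paddr_eq0; [|exact: mulr_ge0 (ltW A0) P0|exact: mulr_ge0 (ltW B0) Q0].
move=> /andP[]; rewrite mulf_eq0 (gt_eqF A0) /= => /eqP p0.
rewrite mulf_eq0 (gt_eqF B0) /= => /eqP q0 x.
rewrite gp gq (poly_int_definite a1 gamma_gt p0) (poly_int_definite b1 gamma_gt q0).
by rewrite !horner0.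
Qed.

Lemma wedge_proj_unique d1 d2 n f g : wedge_L2 d1 d2 f -> poly2_le n g ->
  (forall q, poly2_le n q -> wedge_ip alpha beta gamma d1 d2 (f \- g) q = 0) ->
  forall x, wedge_proj alpha beta gamma d1 d2 n f (x, 1) = g (x, 1) /\
            wedge_proj alpha beta gamma d1 d2 n f (1, x) = g (1, x).
Proof.
move=> Wf Vg gP x; have [Vh hP] := wedge_projP n Wf.
have Vhg : poly2_le n (wedge_proj alpha beta gamma d1 d2 n f \- g).
  rewrite (_ : _ \- _ = fun x => wedge_proj alpha beta gamma d1 d2 n f x + (-1) * g x).
    exact: (poly2_lin_closed n).2.
  by apply/funext => z; rewrite mulN1r.
have ip0 := orth_unique (wedge_semi_ip d1 d2) (poly2_lin_closed n)
  (@poly2_sub_wedge_L2 d1 d2 n) Wf Vg Vh gP hP.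
by have [/eqP + /eqP] := wedge_definite Vhg ip0 x; rewrite !subr_eq0 => /eqP -> /eqP ->.
Qed.

End Wedge.

(** * Approximation with a prescribed value at the corner *)

Section Corner.
Context {R : realType}.
Local Notation w := (@jacobi_weight R).

Lemma jacobi_norm_ge0 (a c : R) f : 0 <= jacobi_norm a c f.
Proof. exact: sqrtr_ge0. Qed.

Lemma jacobi_norm_triangle (a c : R) f g : in_L2 `[0, 1] (w a c) f ->
  in_L2 `[0, 1] (w a c) g ->
  jacobi_norm a c (f \+ g) <= jacobi_norm a c f + jacobi_norm a c g.
Proof. exact: (sip_triangle (jacobi_semi_ip a c)). Qed.

Lemma eq_jacobi_norm (a c a' c' : R) f g :
  (forall x, 0 <= x <= 1 -> f x ^+ 2 * w a c x = g x ^+ 2 * w a' c' x) ->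
  jacobi_norm a c f = jacobi_norm a' c' g.
Proof.
move=> fg; congr Num.sqrt; apply: eq_Rintegral => x; rewrite inE/= in_itv/=.
by move=> /fg; rewrite !expr2.
Qed.

Lemma jacobi_normBC (a c : R) f g : jacobi_norm a c (f \- g) = jacobi_norm a c (g \- f).
Proof. by apply: eq_jacobi_norm => x _ /=; ring. Qed.

Lemma diff_quotK (h : R -> R) x : h x = h 1 + (1 - x) * diff_quot (h 1) h x.
Proof.
rewrite /diff_quot; have [->|x1] := eqVneq x 1; first by rewrite subrr; ring.
by rewrite mulrCA mulfV ?mulr1 ?subr_eq0 1?eq_sym//; ring.
Qed.

Lemma jacobi_weightD2 (a c x : R) : -1 < c -> x <= 1 ->
  w a (c + 2) x = (1 - x) ^+ 2 * w a c x.
Proof.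
move=> c1 x1; have -> : c + 2 = c + 1 + 1 by ring.
by rewrite !jacobi_weightDr//; [ring|lra].
Qed.

(** The factor (1 - x)^2 by which w a (c + 2) differs from w a c cancels the
    square of the denominator. *)
Lemma diff_quot_L2 (a c : R) h : -1 < a -> -1 < c -> in_L2 `[0, 1] (w a c) h ->
  in_L2 `[0, 1] (w a (c + 2)) (diff_quot (h 1) h).
Proof.
move=> a1 c1 Lh; split.
  apply: measurable_funM.
    by apply: measurable_funB => //; case: Lh.
  (* Measurability of the inverse is that of the power -1. *)
  apply: (eq_measurable_fun (fun x : R => (1 - x) `^ (-1))).
    by move=> x; rewrite inE/= in_itv/= => /andP[_ x1]; rewrite powR_inv1 ?subr_ge0.
  have m1 : measurable_fun setT (fun x : R => 1 - x) by exact: measurable_funB.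
  by apply: measurable_funTS; exact: (measurableT_comp (measurable_powR (-1)) m1).
have [_] := lin_closedB (jacobi_semi_ip a c) Lh (poly_in_L2 (h 1)%:P a1 c1).
apply: eq_integrable => // x; rewrite inE/= in_itv/= => /andP[_ x1].
by rewrite jacobi_weightD2// {1}(diff_quotK h x) hornerC; congr EFin; ring.
Qed.

(** For a polynomial q, the norm of diff_quot (h 1) h - q for w a (c + 2) is the
    norm of h - (h 1 + (1 - x) q) for w a c. The second term thus measures
    approximation of h by polynomials with the same value at 1. *)
Definition corner_error (a c : R) (k : nat) (h : R -> R) : R :=
  jacobi_norm a c (h \- jacobi_proj a c k h) +
  jacobi_norm a (c + 2)
    (diff_quot (h 1) h \- jacobi_proj a (c + 2) k (diff_quot (h 1) h)).

(** Correct the best approximation p of h by a polynomial with value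
    h 1 - p 1 at 1. The polynomial h 1 + (1 - x) q, where q is the best
    approximation of the difference quotient, has the right value at 1 but
    degree k + 1; its difference with p is small, and degree_reduction lowers
    the degree. *)
Lemma corner_approximation (a c : R) : -1 < a -> -1 < c ->
  exists2 C : R, 0 < C & forall h k, in_L2 `[0, 1] (w a c) h ->
    exists2 p : {poly R}, (size p <= k.+1)%N & p.[1] = h 1 /\
      jacobi_norm a c (horner p \- h) <= C * corner_error a c k h.
Proof.
move=> a1 c1; have [C C0 CP] := degree_reduction a1 c1.
exists (1 + C) => [|h k Lh]; first by lra.
rewrite /corner_error; set g := diff_quot _ _.
have c3 : -1 < c + 2 by lra.
have Lg := diff_quot_L2 a1 c1 Lh.
have [/poly1_leP[p sp pE] _] := orth_projP (poly1_projectable k a1 c1 Lh).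
have [/poly1_leP[q sq qE] _] := orth_projP (poly1_projectable k a1 c3 Lg).
rewrite -[orth_proj _ _ _]/(jacobi_proj a c k h) in pE.
rewrite -[orth_proj _ _ _]/(jacobi_proj a (c + 2) k g) in qE.
rewrite pE qE => {pE qE}.
pose D := (h 1)%:P + (1 - 'X) * q - p.
have sD : (size D <= k.+2)%N.
  rewrite (leq_trans (size_polyD _ _))// geq_max size_polyN (leq_trans sp)// andbT.
  rewrite (leq_trans (size_polyD _ _))// geq_max (leq_trans (size_polyC_leq1 _))//=.
  rewrite (leq_trans (size_polyMleq _ _))//.
  have : (size (1 - 'X : {poly R})%R <= 2)%N.
    by rewrite (leq_trans (size_polyD _ _))// geq_max size_poly1 size_polyN size_polyX.
  move=> s2; have := leq_add s2 sq; rewrite add2n.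
  by case: (_ + _)%N.
have [r sr [r1 rD]] := CP k D sD.
exists (p + r); first by rewrite (leq_trans (size_polyD _ _))// geq_max sp sr.
have D1 : D.[1] = h 1 - p.[1].
  by rewrite /D !hornerE subrr mul0r addr0.
split; first by rewrite hornerD r1 D1; ring.
have sip := jacobi_semi_ip a c.
have Lp := poly_in_L2 p a1 c1; have Lr := poly_in_L2 r a1 c1.
pose e := horner ((h 1)%:P + (1 - 'X) * q) \- h.
have Le : in_L2 `[0, 1] (w a c) e by apply: (lin_closedB sip) => //; exact: poly_in_L2.
have He : jacobi_norm a c e = jacobi_norm a (c + 2) (g \- horner q).
  apply: eq_jacobi_norm => x /andP[_ x1].
  rewrite jacobi_weightD2// /e/= [h x]diff_quotK -/g.
  rewrite hornerD hornerC hornerM hornerD hornerN hornerX -polyC1 hornerC; ring.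
have HD : jacobi_norm a c (horner D) <=
    jacobi_norm a c e + jacobi_norm a c (h \- horner p).
  have -> : horner D = e \+ (h \- horner p).
    by apply/funext => x; rewrite /D /e /= hornerD hornerN; ring.
  exact: jacobi_norm_triangle Le (lin_closedB sip Lh Lp).
have : jacobi_norm a c (horner (p + r) \- h) <=
    jacobi_norm a c (horner p \- h) + jacobi_norm a c (horner r).
  have -> : horner (p + r) \- h = (horner p \- h) \+ horner r.
    by apply/funext => x; rewrite /= hornerD; ring.
  exact: jacobi_norm_triangle (lin_closedB sip Lp Lh) Lr.
rewrite [jacobi_norm a c (horner p \- h)]jacobi_normBC -He; move: rD HD.
have := jacobi_norm_ge0 a c e; have := jacobi_norm_ge0 a c (h \- horner p).
move: (jacobi_norm a c (horner (p + r) \- h)) => n.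
move: (jacobi_norm a c (horner D)) (jacobi_norm a c (horner r)) => nD nr.
move: (jacobi_norm a c e) (jacobi_norm a c (h \- horner p)) => ne nh.
move=> nh0 ne0 h1 h2 h3; have h4 : C * nD <= C * (ne + nh) by rewrite ler_pM2l.
clear -nh0 ne0 h1 h3 h4; lra.
Qed.

Lemma sqrtr_add_le (x y : R) : 0 <= x -> 0 <= y ->
  Num.sqrt (x + y) <= Num.sqrt x + Num.sqrt y.
Proof.
move=> x0 y0; have s0 : 0 <= Num.sqrt x + Num.sqrt y by rewrite addr_ge0 ?sqrtr_ge0.
rewrite -(ger0_norm s0) -sqrtr_sqr ler_wsqrtr// sqrrD !sqr_sqrtr//.
by rewrite addrAC lerDl mulrn_wge0// mulr_ge0 ?sqrtr_ge0.
Qed.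

Lemma sqrtr_sum_le (I : finType) (F : I -> R) : (forall i, 0 <= F i) ->
  Num.sqrt (\sum_i F i) <= \sum_i Num.sqrt (F i).
Proof.
move=> F0; suff [] : 0 <= \sum_i F i /\ Num.sqrt (\sum_i F i) <= \sum_i Num.sqrt (F i) by [].
elim/big_rec2: _ => [|i x y _ [y0 yx]]; first by rewrite sqrtr0.
split; first exact: addr_ge0.
by apply: (le_trans (sqrtr_add_le (F0 i) y0)); rewrite lerD2l.
Qed.

Variables alpha beta gamma : R.
Hypotheses (alpha_gt : -1 < alpha) (beta_gt : -1 < beta) (gamma_gt : -1 < gamma).

(** Two univariate polynomials of degree k with the common value l at 1 glue to
    the polynomial p1(x) + p2(y) - l of total degree k, which the projection
    can only improve upon. *)
Lemma wedge_error_le (d1 d2 : bool) : exists C : R, 0 < C /\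
  forall H k, wedge_L2 alpha beta gamma d1 d2 H ->
    wedge_norm alpha beta gamma d1 d2
      (wedge_proj alpha beta gamma d1 d2 k H \- H) <=
    C * (corner_error (alpha + d1%:R) gamma k (fun x => H (x, 1)) +
         corner_error (beta + d2%:R) gamma k (fun y => H (1, y))).
Proof.
set a := alpha + d1%:R; set b := beta + d2%:R.
have a1 : -1 < a := shift_gt d1 alpha_gt; have b1 : -1 < b := shift_gt d2 beta_gt.
have A0 := jacobi_const_gt0 a1 gamma_gt.
have B0 := mulr_gt0 (wedge_sigma_gt0 alpha_gt beta_gt gamma_gt d1 d2)
  (jacobi_const_gt0 b1 gamma_gt).
have [C1 C10 C1P] := corner_approximation a1 gamma_gt.
have [C2 C20 C2P] := corner_approximation b1 gamma_gt.
set A := jacobi_const _ _ in A0 B0; set B := _ * jacobi_const _ _ in B0.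
exists (Num.sqrt A * C1 + Num.sqrt B * C2); split=> [|H k WH].
  by rewrite addr_gt0// mulr_gt0// sqrtr_gt0.
set H1 := fun x => H (x, 1); set H2 := fun x => H (1, x).
have [L1 L2] := WH.
have [p1 sp1 [p1l p1e]] := C1P H1 k L1.
have [p2 sp2 [p2l p2e]] := C2P H2 k L2.
pose l := H (1, 1).
pose P : R * R -> R := fun z => p1.[z.1] + 1 * (p2.[z.2] + (- l) * monomial 0 0 z).
have VP : poly2_le k P.
  apply: (poly2_lin_closed k).2; first exact: poly2_fst.
  apply: (poly2_lin_closed k).2; first exact: poly2_snd.
  exact: poly2_monomial.
have [VS SP] := wedge_projP alpha_gt beta_gt gamma_gt k WH.
have best := orth_best (wedge_semi_ip alpha_gt beta_gt gamma_gt d1 d2)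
  (poly2_lin_closed k)
  (@poly2_sub_wedge_L2 _ _ _ _ alpha_gt beta_gt gamma_gt d1 d2 k) WH VS VP SP.
apply: (le_trans (ler_wsqrtr best)).
have -> : wedge_ip alpha beta gamma d1 d2 (P \- H) (P \- H) =
    A * jacobi_ip a gamma (horner p1 \- H1) (horner p1 \- H1) +
    B * jacobi_ip b gamma (horner p2 \- H2) (horner p2 \- H2).
  rewrite /wedge_ip; congr (_ * _ + _ * _); apply: eq_Rintegral => x _ /=.
    by rewrite /P /monomial /H1 /= p2l /H2 /l /=; ring.
  by rewrite /P /monomial /H2 /= p1l /H1 /l /=; ring.
have J1 := sip_ge0 (jacobi_semi_ip a gamma)
  (lin_closedB (jacobi_semi_ip a gamma) (poly_in_L2 p1 a1 gamma_gt) L1).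
have J2 := sip_ge0 (jacobi_semi_ip b gamma)
  (lin_closedB (jacobi_semi_ip b gamma) (poly_in_L2 p2 b1 gamma_gt) L2).
apply: (le_trans (sqrtr_add_le (mulr_ge0 (ltW A0) J1) (mulr_ge0 (ltW B0) J2))).
rewrite (sqrtrM _ (ltW A0)) (sqrtrM _ (ltW B0)).
move: p1e p2e; rewrite /jacobi_norm.
move: (jacobi_ip a gamma (_ \- _) _) (jacobi_ip b gamma (_ \- _) _) => n1 n2.
have E0 (a' c : R) h : 0 <= corner_error a' c k h.
  by rewrite addr_ge0 ?jacobi_norm_ge0.
move: (E0 a gamma H1) (E0 b gamma H2).
move: (corner_error a gamma k H1) (corner_error b gamma k H2) => E1 E2 E10 E20.
move=> N1 N2; rewrite mulrDl; apply: lerD; rewrite -mulrA ler_wpM2l ?sqrtr_ge0//.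
  by apply: (le_trans N1); rewrite ler_pM2l// lerDl.
by apply: (le_trans N2); rewrite ler_pM2l// lerDr.
Qed.

End Corner.

(** * The substitution t = x^2 *)

Section SquareRoot.
Context {R : realType}.
Local Notation mu := (@lebesgue_measure R).
Local Notation cc01 := (`[(0%R : R), (1%R : R)]%classic).

Lemma measurable_sqrt : measurable_fun setT (@Num.sqrt R).
Proof. exact: continuous_measurable_fun (@sqrt_continuous R). Qed.

Let unif := uniform_prob (@ltr01 R).

Lemma beta_pdf21 (x : R) : 0 <= x <= 1 -> beta_pdf 2 1 x = 2 * x.
Proof.
move=> x01; rewrite /beta_pdf patchE mem_set ?in_itv//= /XMonemX expr0 mulr1 expr1.
rewrite (beta_fun_fact 1 0) -[(1`! * 0`!)%N]/1%N -[(1 + 0).+1`!]/2%N.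
by rewrite mul1r invrK mulrC.
Qed.

Lemma beta_pdf_out (a b : nat) (x : R) : ~~ (0 <= x <= 1) -> beta_pdf a b x = 0.
Proof.
by move=> x01; rewrite /beta_pdf patchE memNset ?mul0r//= in_itv/=; exact/negP.
Qed.

Lemma integral_beta21 (A : set R) : measurable A ->
  beta_prob 2 1 A = (\int[mu]_(x in A `&` cc01) (2 * x)%:E)%E.
Proof.
move=> mA; rewrite -integral_beta_pdf// [RHS]integral_mkcondr.
apply: eq_integral => x _; rewrite patchE; case: ifPn.
  by rewrite inE/= in_itv/= => x01; rewrite beta_pdf21.
by rewrite notin_setE/= in_itv/= => /negP x01; rewrite beta_pdf_out.
Qed.

Lemma integral_unif (A : set R) : measurable A -> unif A = mu (A `&` cc01).
Proof.
move=> mA; rewrite /unif /uniform_prob integral_uniform_pdf.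
rewrite (eq_integral (cst 1%E)) ?integral_cst ?mul1e//; first exact: measurableI.
move=> x; rewrite inE /= => -[_]; rewrite in_itv/= /uniform_pdf => ->.
by rewrite subr0 invr1.
Qed.

Lemma beta_prob_sqrt_ray (x : R) :
  beta_prob 2 1 `]-oo, x[ = unif (@Num.sqrt R @^-1` `]-oo, x[).
Proof.
have mpre : measurable (@Num.sqrt R @^-1` `]-oo, x[).
  by rewrite -[X in measurable X]setTI; exact: measurable_sqrt.
rewrite integral_beta21// integral_unif//.
have [x0|x0] := leP x 0.
  rewrite (_ : _ `&` _ = set0); last first.
    apply/seteqP; split => // y []; rewrite /= !in_itv/= => yx /andP[y0 _].
    by move: (lt_le_trans yx x0); rewrite ltNge y0.
  rewrite (_ : _ `&` _ = set0); last first.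
    apply/seteqP; split => // y []; rewrite /= !in_itv/= => yx _.
    by move: (lt_le_trans yx x0); rewrite ltNge sqrtr_ge0.
  by rewrite integral_set0 measure0.
have [x1|x1] := leP x 1; last first.
  have -> : `]-oo, x[%classic `&` cc01 = cc01.
    apply/setIidPr => y; rewrite /= !in_itv/= => /andP[_ y1].
    exact: le_lt_trans y1 x1.
  have -> : (@Num.sqrt R @^-1` `]-oo, x[) `&` cc01 = cc01.
    apply/setIidPr => y; rewrite /= !in_itv/= => /andP[_ y1].
    by rewrite (le_lt_trans _ x1)// -sqrtr1 ler_wsqrtr.
  have := beta_prob01 2 1 (R := R); rewrite integral_beta21// setIid => ->.
  by rewrite lebesgue_measure_itv/= lte_fin ltr01 oppr0 adde0.
have -> : `]-oo, x[%classic `&` cc01 = `[0, x[%classic.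
  apply/seteqP; split => y; rewrite /= !in_itv/=.
    by move=> [-> /andP[-> _]].
  move=> /andP[y0 yx]; split => //.
  by rewrite y0 (ltW (lt_le_trans yx x1)).
have -> : (@Num.sqrt R @^-1` `]-oo, x[) `&` cc01 = `[0, x ^+ 2[%classic.
  have E y : 0 <= y -> (Num.sqrt y < x) = (y < x ^+ 2).
    by move=> y0; rewrite -{2}(sqr_sqrtr y0) ltr_pXn2r// ?nnegrE ?sqrtr_ge0// ltW.
  apply/seteqP; split => y; rewrite /= !in_itv/=.
    by move=> [yx /andP[y0 _]]; rewrite y0/= -E.
  move=> /andP[y0 yx]; rewrite E// yx y0; split => //=.
  by rewrite (le_trans (ltW yx))// expr_le1// ltW.
rewrite lebesgue_measure_itv/= lte_fin exprn_gt0// oppr0 adde0.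
rewrite integral_itv_bndo_bndc; last first.
  by apply/measurable_EFinP; apply: measurable_funM.
have dF y : 0 <= y <= x -> is_derive y 1 (fun y : R => y ^+ 2) (2 * y).
  by move=> _; apply: is_derive_eq; rewrite /GRing.scale/=; ring.
have cf y : 0 <= y <= x -> {for y, continuous (fun y : R => 2 * y)}.
  by move=> _; apply: cvgM; [exact: cvg_cst|exact: cvg_id].
by rewrite (FTC_is_derive x0 dF cf) expr0n/= sube0.
Qed.

(* The codomain of the square root carries here the sigma-algebra on which the
   measures live. *)
Let sq : measurableTypeR R -> measurableTypeR R := @Num.sqrt R.

Let measurable_sq : measurable_fun setT sq.
Proof. exact: measurable_sqrt. Qed.

(** If t is uniform on [0, 1], its square root has density 2 x, that of the
    Beta(2, 1) law: the distribution functions coincide, and the open rays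
    generate the Borel sets. This is the substitution t = x^2 for arbitrary
    measurable integrands. *)
Lemma beta_prob_sqrt (A : set (measurableTypeR R)) : measurable A ->
  beta_prob 2 1 A = pushforward unif sq A.
Proof.
pose G : set (set (measurableTypeR R)) := @RGenInftyO.G R.
pose g (n : nat) : set (measurableTypeR R) := `]-oo, n%:R[%classic.
have H := @measure_unique _ R (measurableTypeR R) G g.
apply: H.
- exact: RGenInftyO.measurableE.
- move=> _ _ [x ->] [y ->]; exists (Num.min x y).
  apply/seteqP; split => z; rewrite /= !in_itv/= lt_min; first by move=> [-> ->].
  by move=> /andP[-> ->].
- by move=> n; exists n%:R.
- apply/seteqP; split => // x _; exists (Num.bound `|x|) => //.
  by rewrite /g/= in_itv/= (le_lt_trans (ler_norm x))// archi_boundP.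
- by move=> _ [x ->]; exact: beta_prob_sqrt_ray.
- by move=> n; rewrite -ge0_fin_numE// beta_prob_fin_num//; exact: measurable_itv.
Qed.

Lemma ge0_integral_sqrt_bounded (g : R -> R) M : measurable_fun setT g ->
  (forall x, 0 <= g x <= M) ->
  (\int[mu]_(x in cc01) (g (Num.sqrt x))%:E = \int[mu]_(x in cc01) (g x * (2 * x))%:E)%E.
Proof.
move=> mg gM; have g0 x : 0 <= g x by case/andP: (gM x).
transitivity (\int[unif]_x (g (sq x))%:E)%E.
  rewrite integral_uniform; first by rewrite subr0 invr1 mul1e.
    apply/measurable_EFinP; exact: (measurableT_comp mg measurable_sqrt).
  by move=> x; rewrite lee_fin.
transitivity (\int[pushforward unif sq]_x (g x)%:E)%E.
  rewrite ge0_integral_pushforward//; first exact/measurable_EFinP.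
  by move=> x _; rewrite lee_fin.
transitivity (\int[beta_prob 2 1]_x (g x)%:E)%E.
  by apply: eq_measure_integral => A mA _; rewrite [RHS]beta_prob_sqrt.
rewrite integral_beta_prob//; last 2 first.
- exact/measurable_EFinP.
- apply: (@le_lt_trans _ _ (\int[beta_prob 2 1]_(x in setT) (cst M%:E x))%E).
    apply: ge0_le_integral => //.
    + by apply: measurableT_comp => //; exact/measurable_EFinP.
    + by move=> x _; rewrite /= ger0_norm// lee_fin; case/andP: (gM x).
  have M0 : 0 <= M by case/andP: (gM 0) => /le_trans; apply.
  by rewrite integral_cst// lte_mul_pinfty// ltey_eq beta_prob_fin_num.
rewrite [RHS]integral_mkcond; apply: eq_integral => x _; rewrite patchE -EFinM.
case: ifPn; first by rewrite inE/= in_itv/= => x01; rewrite beta_pdf21.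
by rewrite notin_setE/= in_itv/= => /negP x01; rewrite beta_pdf_out// mulr0.
Qed.

(** Truncation at n, since the change of law above is for functions of finite
    mean. *)
Lemma ge0_integral_sqrt (g : R -> R) : measurable_fun setT g -> (forall x, 0 <= g x) ->
  (\int[mu]_(x in cc01) (g (Num.sqrt x))%:E = \int[mu]_(x in cc01) (g x * (2 * x))%:E)%E.
Proof.
move=> mg g0.
pose gn n x := Num.min (g x) n%:R.
have mgn n : measurable_fun setT (gn n) by exact: measurable_minr.
have gn0 n x : 0 <= gn n x by rewrite le_min g0 ler0n.
have gnhomo x : {homo (gn ^~ x) : m n / (m <= n)%N >-> m <= n}.
  by move=> m n mn; rewrite /gn le_min ge_min lexx/= ge_min ler_nat mn orbT.
have gnlim x : \forall n \near \oo, gn n x = g x.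
  exists (Num.bound (g x)) => // n /= gxn; apply/min_idPl.
  by rewrite (le_trans (ltW (archi_boundP (g0 x))))// ler_nat.
transitivity (limn (fun n => \int[mu]_(x in cc01) (gn n (Num.sqrt x))%:E)%E).
  rewrite -monotone_convergence//.
  - apply: eq_integral => x _; apply/esym/cvg_lim => //; apply: cvg_near_cst.
    by apply: filterS (gnlim (Num.sqrt x)) => n ->.
  - move=> n; apply/measurable_EFinP/measurable_funTS.
    exact: (measurableT_comp (mgn n) measurable_sqrt).
  - by move=> n x _; rewrite lee_fin.
  - by move=> x _ m n mn; rewrite lee_fin gnhomo.
transitivity (limn (fun n => \int[mu]_(x in cc01) (gn n x * (2 * x))%:E)%E).
  apply: congr_lim; apply/funext => n.
  apply: (ge0_integral_sqrt_bounded (M := n%:R)) => // x.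
  by rewrite gn0 ge_min lexx orbT.
rewrite -monotone_convergence//.
- apply: eq_integral => x _; apply/cvg_lim => //; apply: cvg_near_cst.
  by apply: filterS (gnlim x) => n ->.
- move=> n; apply/measurable_EFinP/measurable_funTS.
  by apply: measurable_funM; [exact: mgn|apply: measurable_funM].
- move=> n x; rewrite /= in_itv/= => /andP[x0 _].
  by rewrite lee_fin !mulr_ge0.
- move=> x; rewrite /= in_itv/= => /andP[x0 _] m n mn.
  by rewrite lee_fin ler_wpM2r ?mulr_ge0// gnhomo.
Qed.

End SquareRoot.

Section SymWeight.
Context {R : realType}.
Local Notation mu := (@lebesgue_measure R).
Local Notation w := (@jacobi_weight R).
Local Notation oo01 := (`](0%R : R), (1%R : R)[%classic).
Local Notation cc01 := (`[(0%R : R), (1%R : R)]%classic).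
Implicit Types (g u h : R -> R).

Lemma sym_weight_ge0 (a c : R) x : 0 <= sym_weight a c x.
Proof. by rewrite mulr_ge0 ?powR_ge0. Qed.

Lemma measurable_sym_weight (a c : R) (D : set R) : measurable_fun D (sym_weight a c).
Proof.
apply: measurable_funTS; apply: measurable_funM.
  exact: (measurableT_comp (measurable_powR _) (@normr_measurable R setT)).
have m1 : measurable_fun setT (fun x : R => 1 - x ^+ 2).
  by apply: measurable_funB => //; exact: measurable_funX.
exact: (measurableT_comp (measurable_powR c) m1).
Qed.

Lemma sqrt_powR2 (a t : R) : 0 <= t -> Num.sqrt t `^ (2 * a) = t `^ a.
Proof.
by move=> t0; rewrite -powR12_sqrt// -powRrM mulrA mulVf// mul1r.
Qed.

Lemma sqrt_itv01 (t : R) : 0 <= t <= 1 -> 0 <= Num.sqrt t <= 1.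
Proof. by move=> /andP[t0 t1]; rewrite sqrtr_ge0 -sqrtr1 ler_wsqrtr. Qed.

Local Notation sym_itv := (`[(-1 : R), (1 : R)]%classic).

(** One of the 2 a + 1 factors x of the weight is, up to 1/2, the density of the
    square root. *)
Lemma ge0_sym_weight_half (a c : R) u : measurable_fun setT u -> (forall x, 0 <= u x) ->
  (\int[mu]_(x in cc01) (u x * sym_weight a c x)%:E =
   \int[mu]_(t in cc01) (2^-1 * u (Num.sqrt t) * w a c t)%:E)%E.
Proof.
move=> mu_ u0.
pose g x := 2^-1 * u x * (`|x| `^ (2 * a) * (1 - x ^+ 2) `^ c).
have mg : measurable_fun setT g.
  apply: measurable_funM; first exact: measurable_funM.
  apply: measurable_funM.
    exact: (measurableT_comp (measurable_powR _) (@normr_measurable R setT)).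
  have m1 : measurable_fun setT (fun x : R => 1 - x ^+ 2).
    by apply: measurable_funB => //; exact: measurable_funX.
  exact: (measurableT_comp (measurable_powR c) m1).
have g0 x : 0 <= g x by rewrite !mulr_ge0 ?powR_ge0.
have gx x : oo01 x -> g x * (2 * x) = u x * sym_weight a c x.
  rewrite /= in_itv/= => /andP[x0 x1].
  rewrite /g /sym_weight (gtr0_norm x0) powRD ?powRr1 ?(ltW x0)//; last first.
    by rewrite (gt_eqF x0) implybT.
  by field.
have gs t : 0 <= t <= 1 -> g (Num.sqrt t) = 2^-1 * u (Num.sqrt t) * w a c t.
  move=> /andP[t0 t1].
  by rewrite /g ger0_norm ?sqrtr_ge0// sqrt_powR2// sqr_sqrtr.
transitivity (\int[mu]_(x in cc01) (g x * (2 * x))%:E)%E; last first.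
  rewrite -(ge0_integral_sqrt mg g0); apply: eq_integral => t.
  by rewrite inE/= in_itv/= => t01; rewrite gs.
rewrite [LHS]integral_itv_bndoo; last first.
  apply/measurable_EFinP; apply: measurable_funM; last exact: measurable_sym_weight.
  exact: measurable_funTS.
rewrite [RHS]integral_itv_bndoo; last first.
  by apply/measurable_EFinP/measurable_funTS; do 2 apply: measurable_funM => //.
by apply: eq_integral => x; rewrite inE => /gx ->.
Qed.

Lemma ge0_integral_reflect h : measurable_fun setT h -> (forall x, 0 <= h x) ->
  (\int[mu]_(x in `[(-1)%R, 0%R]) (h x)%:E = \int[mu]_(x in cc01) (h (- x))%:E)%E.
Proof.
move=> mh h0; have mopp : measurable_fun setT (fun x : R => - x) by exact: oppr_measurable.
pose k x : \bar R := (((fun x => (h (- x))%:E) \_ cc01) x)%E.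
have mk : measurable_fun setT k.
  apply/(measurable_restrictT _ _).1 => //; apply/measurable_EFinP/measurable_funTS.
  exact: (measurableT_comp mh mopp).
have k0 x : (0 <= k x)%E by apply: erestrict_ge0 => y _; rewrite lee_fin.
have := ge0_integration_by_substitution0 mk k0; rewrite /k.
rewrite -integral_mkcondr (_ : _ `&` _ = cc01); last first.
  by apply/setIidPr => x; rewrite /= !in_itv/= andbT => /andP[].
move=> ->.
rewrite [LHS]integral_mkcond [RHS]integral_mkcond; apply: eq_integral => x _.
rewrite !patchE !mem_setE !in_itv/= oppr_ge0 lerNl opprK.
by case: (x <= 0); rewrite ?andbT ?andbF.
Qed.

Lemma ge0_sym_weight_fold (a c : R) u : measurable_fun setT u -> (forall x, 0 <= u x) ->
  (\int[mu]_(x in sym_itv) (u x * sym_weight a c x)%:E =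
   \int[mu]_(t in cc01) (2^-1 * (u (Num.sqrt t) + u (- Num.sqrt t)) * w a c t)%:E)%E.
Proof.
move=> mu_ u0.
have mopp : measurable_fun setT (fun x : R => - x) by exact: oppr_measurable.
have mu' : measurable_fun setT (fun x : R => u (- x)) by exact: (measurableT_comp mu_ mopp).
have mus : measurable_fun setT (fun x => u x * sym_weight a c x).
  by apply: measurable_funM => //; exact: measurable_sym_weight.
have us0 x : 0 <= u x * sym_weight a c x by rewrite mulr_ge0 ?sym_weight_ge0.
have -> : sym_itv = `[-1, 0]%classic `|` `]0, 1]%classic.
  apply/seteqP; split => x; rewrite /= !in_itv/=.
    by case: (leP x 0) => x0 /andP[-> ->]; [left|right].
  by move=> [/andP[-> x0]|/andP[x0 ->]]; rewrite ?andbT /=; lra.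
rewrite ge0_integral_setU//=; last 3 first.
- by apply/measurable_EFinP/measurable_funTS.
- by move=> x _; rewrite lee_fin.
- apply/disj_setPS => x [/=]; rewrite !in_itv/= => /andP[_ x0] /andP[x1 _].
  by move: (lt_le_trans x1 x0); rewrite ltxx.
rewrite ge0_integral_reflect//.
rewrite integral_itv_obnd_cbnd; last by apply/measurable_EFinP/measurable_funTS.
rewrite ge0_sym_weight_half//.
under eq_integral do rewrite /sym_weight normrN sqrrN -/(sym_weight _ _ _).
have mh (v : R -> R) : measurable_fun setT v ->
    measurable_fun cc01 (fun t => (2^-1 * v (Num.sqrt t) * w a c t)%:E).
  move=> mv; apply/measurable_EFinP; apply: measurable_funM.
    apply: measurable_funTS; apply: measurable_funM => //.
    exact: (measurableT_comp mv measurable_sqrt).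
  exact: measurable_jacobi_weightS.
have h0 (v : R -> R) t : (forall x, 0 <= v x) -> 0 <= 2^-1 * v (Num.sqrt t) * w a c t.
  move=> v0; apply: mulr_ge0 (jacobi_weight_ge0 _ _ _).
  by apply: mulr_ge0 (v0 _); rewrite invr_ge0.
rewrite (ge0_sym_weight_half _ _ mu')// addeC -ge0_integralD//; last 4 first.
- by move=> x _; rewrite lee_fin h0.
- exact: mh.
- by move=> x _; rewrite lee_fin (h0 (fun x : R => u (- x))).
- exact: (mh (fun x : R => u (- x))).
by apply: eq_integral => t _; rewrite -EFinD; congr EFin; ring.
Qed.

(** The nonnegative case applies to |u| and |u| + u, extended by 0 outside
    [-1, 1], and u is their difference. *)
Lemma sym_weight_fold (a c : R) u : measurable_fun sym_itv u ->
  mu.-integrable sym_itv (fun x => (u x * sym_weight a c x)%:E) ->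
  let v t := 2^-1 * (u (Num.sqrt t) + u (- Num.sqrt t)) * w a c t in
  mu.-integrable cc01 (EFin \o v) /\
  \int[mu]_(x in sym_itv) (u x * sym_weight a c x) = \int[mu]_(t in cc01) v t.
Proof.
move=> mu_ Iu v.
have mS : measurable (sym_itv : set (measurableTypeR R)) by exact: measurable_itv.
have mC : measurable (cc01 : set (measurableTypeR R)) by exact: measurable_itv.
pose z := u \_ sym_itv.
have mz : measurable_fun setT z by apply/(measurable_restrictT _ _).1.
have mN : measurable_fun setT (fun x => `|z x|) by exact: measurableT_comp.
pose nz x := `|z x|; pose pz x := `|z x| + z x.
have nz0 x : 0 <= nz x by exact: normr_ge0.
have pz0 x : 0 <= pz x by rewrite /pz -lerBlDr sub0r -normrN ler_norm.
have zu (x : R) : -1 <= x <= 1 -> z x = u x.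
  by move=> x01; rewrite /z patchE mem_set//= in_itv/= x01.
have zs (t : R) : 0 <= t <= 1 -> z (Num.sqrt t) = u (Num.sqrt t) /\
    z (- Num.sqrt t) = u (- Num.sqrt t).
  by move=> /sqrt_itv01 /andP[? ?]; rewrite !zu//; apply/andP; split; lra.
pose fold (y : R -> R) t := 2^-1 * (y (Num.sqrt t) + y (- Num.sqrt t)) * w a c t.
have mfold (y : R -> R) : measurable_fun setT y -> measurable_fun cc01 (fold y).
  move=> my; apply: measurable_funM; last exact: measurable_jacobi_weightS.
  apply: measurable_funTS; apply: measurable_funM => //.
  apply: measurable_funD; first exact: (measurableT_comp my measurable_sqrt).
  have ms : measurable_fun setT (fun t : R => - Num.sqrt t).
    by apply: measurableT_comp => //; exact: measurable_sqrt.
  exact: (measurableT_comp my ms).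
have fold0 (y : R -> R) t : (forall x, 0 <= y x) -> 0 <= fold y t.
  move=> y0; apply: mulr_ge0 (jacobi_weight_ge0 _ _ _).
  by apply: mulr_ge0 (addr_ge0 (y0 _) (y0 _)); rewrite invr_ge0.
have Eu : mu.-integrable sym_itv (fun x => (z x * sym_weight a c x)%:E).
  apply: (eq_integrable mS _ _ _ Iu) => x; rewrite inE/= in_itv/= => x01.
  by rewrite zu.
have En : mu.-integrable sym_itv (fun x => (nz x * sym_weight a c x)%:E).
  apply: (eq_integrable mS _ _ _ (integrable_norm Eu)) => x _ /=.
  by rewrite normrM (ger0_norm (sym_weight_ge0 _ _ _)).
have ge0_fold (y : R -> R) : measurable_fun setT y -> (forall x, 0 <= y x) ->
    mu.-integrable sym_itv (fun x => (y x * sym_weight a c x)%:E) ->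
    mu.-integrable cc01 (EFin \o fold y) /\
    \int[mu]_(x in sym_itv) (y x * sym_weight a c x) = \int[mu]_(t in cc01) fold y t.
  move=> my y0 /integrableP[_ Iy]; split; last exact: (congr1 fine (ge0_sym_weight_fold a c my y0)).
  apply/integrableP; split; first by apply/measurable_EFinP; exact: mfold.
  under eq_integral => t _.
    rewrite /= ger0_norm; last exact: fold0.
    over.
  rewrite -(ge0_sym_weight_fold a c my y0); apply: le_lt_trans Iy.
  rewrite le_eqVlt; apply/orP; left; apply/eqP; apply: eq_integral => x _ /=.
  by rewrite ger0_norm// mulr_ge0// sym_weight_ge0.
have [If1 E1] := ge0_fold _ mN nz0 En.
have Ep : mu.-integrable sym_itv (fun x => (pz x * sym_weight a c x)%:E).
  have I := integrableD mS En Eu.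
  by apply: (eq_integrable mS _ _ _ I) => x _; rewrite -EFinD -mulrDl.
have [If2 E2] := ge0_fold _ (measurable_funD mN mz) pz0 Ep.
have foldz t : fold z t = fold pz t - fold nz t by rewrite /fold /pz /nz; ring.
have vz t : 0 <= t <= 1 -> v t = fold z t by move=> /zs[E3 E4]; rewrite /fold E3 E4.
have Iv : mu.-integrable cc01 (EFin \o v).
  have I := integrableB mC If2 If1.
  apply: (eq_integrable mC _ _ _ I) => x.
  by rewrite inE/= in_itv/= => /vz ->; rewrite foldz.
split; first exact: Iv.
transitivity (\int[mu]_(x in sym_itv) (pz x * sym_weight a c x - nz x * sym_weight a c x)).
  apply: eq_Rintegral => x; rewrite inE/= in_itv/= => /zu <-.
  by rewrite /pz /nz; ring.
rewrite (RintegralB mS Ep En) E1 E2.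
rewrite -(RintegralB mC If2 If1); apply: eq_Rintegral => t.
by rewrite inE/= in_itv/= => /vz ->; rewrite foldz.
Qed.

End SymWeight.

(** * From the square to the wedges *)

Section Parity.
Context {R : realType}.
Implicit Types (f g : R * R -> R).

(** The inverse of the decomposition of a function on the square into its four
    functions wedge_part d1 d2. *)
Definition unfold_parts (h : bool -> bool -> R * R -> R) (z : R * R) : R :=
  h false false (z.1 ^+ 2, z.2 ^+ 2) + z.2 * h false true (z.1 ^+ 2, z.2 ^+ 2)
  + z.1 * h true false (z.1 ^+ 2, z.2 ^+ 2)
  + z.1 * z.2 * h true true (z.1 ^+ 2, z.2 ^+ 2).

Lemma parity_part_unfold (d1 d2 : bool) (h : bool -> bool -> R * R -> R) (z : R * R) :
  parity_part d1 d2 (unfold_parts h) z = z.1 ^+ d1 * z.2 ^+ d2 * h d1 d2 (z.1 ^+ 2, z.2 ^+ 2).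
Proof.
rewrite /parity_part /unfold_parts /= !sqrrN.
by case: d1; case: d2 => /=; rewrite ?expr0 ?expr1 ?sqrrN ?sqrr_sign; field.
Qed.

Lemma wedge_part_unfold (d1 d2 : bool) (h : bool -> bool -> R * R -> R) (x y : R) :
  0 <= x -> 0 <= y -> (d1 -> x != 0) -> (d2 -> y != 0) ->
  wedge_part d1 d2 (unfold_parts h) (x, y) = h d1 d2 (x, y).
Proof.
move=> x0 y0 dx dy; rewrite /wedge_part /parity_quot /= parity_part_unfold /=.
rewrite !sqr_sqrtr//.
have sx : d1 -> Num.sqrt x != 0 by move/dx; rewrite sqrtr_eq0 -ltNge lt_neqAle eq_sym x0 andbT.
have sy : d2 -> Num.sqrt y != 0 by move/dy; rewrite sqrtr_eq0 -ltNge lt_neqAle eq_sym y0 andbT.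
have nx : Num.sqrt x ^+ d1 != 0 by case: (d1) sx => [->//|_]; rewrite expr0 oner_neq0.
have ny : Num.sqrt y ^+ d2 != 0 by case: (d2) sy => [->//|_]; rewrite expr0 oner_neq0.
by field; rewrite nx ny.
Qed.

Lemma wedge_partB (d1 d2 : bool) f g : wedge_part d1 d2 (f \- g) =
  wedge_part d1 d2 f \- wedge_part d1 d2 g.
Proof.
apply/funext => z; rewrite /wedge_part /parity_quot /parity_part /=; ring.
Qed.

Definition part_degree (n : nat) (d1 d2 : bool) := ((n - d1 - d2) %/ 2)%N.

Lemma part_degree_le n (d1 d2 : bool) : (2 <= n)%N ->
  (d1 + d2 + (part_degree n d1 d2).*2 <= n)%N.
Proof.
move=> n2; rewrite /part_degree -muln2.
have dn : (d1 + d2 <= n)%N by apply: leq_trans n2; case: d1 d2 => [] [].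
by rewrite -subnDA -{2}(subnKC dn) leq_add2l leq_trunc_div.
Qed.

Lemma poly2_unfold n k (d1 d2 : bool) (h : R * R -> R) : (d1 + d2 + k.*2 <= n)%N ->
  poly2_le k h ->
  poly2_le n (fun z : R * R => z.1 ^+ d1 * z.2 ^+ d2 * h (z.1 ^+ 2, z.2 ^+ 2)).
Proof.
move=> dkn; apply: (poly2_ind (P := [set h | @poly2_le R n
  (fun z : R * R => z.1 ^+ d1 * z.2 ^+ d2 * h (z.1 ^+ 2, z.2 ^+ 2))])).
  have [V0 Vl] := @poly2_lin_closed R n; split => [|a f g /= Vf Vg].
    rewrite /= (_ : (fun z => _) = fun=> 0)//.
    by apply/funext => z; rewrite mulr0.
  rewrite (_ : (fun z => _) = fun z => z.1 ^+ d1 * z.2 ^+ d2 * f (z.1 ^+ 2, z.2 ^+ 2)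
      + a * (z.1 ^+ d1 * z.2 ^+ d2 * g (z.1 ^+ 2, z.2 ^+ 2))); first exact: Vl.
  by apply/funext => z; ring.
move=> i j ijk /=; rewrite (_ : (fun z => _) = monomial (d1 + i.*2) (d2 + j.*2)).
  apply: poly2_monomial; apply: leq_trans dkn.
  by rewrite addnACA -doubleD leq_add2l leq_double.
apply/funext => z; rewrite /monomial !exprD -!mul2n !exprM; ring.
Qed.

Lemma unfold_partsE (h : bool -> bool -> R * R -> R) : unfold_parts h = fun z =>
  ((z.1 ^+ false * z.2 ^+ false * h false false (z.1 ^+ 2, z.2 ^+ 2)
   + 1 * (z.1 ^+ false * z.2 ^+ true * h false true (z.1 ^+ 2, z.2 ^+ 2)))
   + 1 * (z.1 ^+ true * z.2 ^+ false * h true false (z.1 ^+ 2, z.2 ^+ 2)))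
   + 1 * (z.1 ^+ true * z.2 ^+ true * h true true (z.1 ^+ 2, z.2 ^+ 2)).
Proof. by apply/funext => z; rewrite /unfold_parts /=; ring. Qed.

Lemma unfold_parts_poly n h : (2 <= n)%N ->
  (forall d1 d2, poly2_le (part_degree n d1 d2) (h d1 d2)) ->
  poly2_le n (unfold_parts h).
Proof.
move=> n2 Vh; have [_ Vl] := @poly2_lin_closed R n.
have V d1 d2 := poly2_unfold (part_degree_le d1 d2 n2) (Vh d1 d2).
rewrite unfold_partsE.
exact: Vl (Vl _ _ _ (Vl _ _ _ (V false false) (V false true)) (V true false)) (V true true).
Qed.

(** A monomial x^(d1 + 2 i) y^(d2 + 2 j) comes from x^i y^j in the part of
    parities d1, d2. *)
Lemma poly_unfold_parts n q : (2 <= n)%N -> poly2_le n q ->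
  exists2 h, (forall d1 d2, poly2_le (part_degree n d1 d2) (h d1 d2)) &
    q = unfold_parts h.
Proof.
move=> n2; apply: (poly2_ind (P := [set q | exists2 h,
  (forall d1 d2, @poly2_le R (part_degree n d1 d2) (h d1 d2)) & q = unfold_parts h])).
  split.
    exists (fun _ _ _ => 0) => [d1 d2|]; first exact: (poly2_lin_closed _).1.
    by apply/funext => z; rewrite /unfold_parts; ring.
  move=> a _ _ [f Vf ->] [g Vg ->].
  exists (fun d1 d2 z => f d1 d2 z + a * g d1 d2 z) => [d1 d2|].
    exact: (poly2_lin_closed _).2.
  by apply/funext => z; rewrite /unfold_parts; ring.
move=> i j ijn.
exists (fun d1 d2 => if (d1 == odd i) && (d2 == odd j) then monomial i./2 j./2 else fun=> 0).
  move=> d1 d2; case: ifP => [/andP[/eqP -> /eqP ->]|_]; last exact: (poly2_lin_closed _).1.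
  apply: poly2_monomial; rewrite /part_degree leq_divRL// muln2 doubleD.
  rewrite -subnDA leq_subRL; last by apply: leq_trans n2; case: (odd i) (odd j) => [] [].
  by rewrite addnACA !odd_double_half.
apply/funext => z; rewrite /unfold_parts /monomial.
rewrite -{1}(odd_double_half i) -{1}(odd_double_half j) !exprD -!mul2n !exprM.
by case: (odd i); case: (odd j) => /=; ring.
Qed.

End Parity.

Section Edges.
Context {R : realType}.
Local Notation mu := (@lebesgue_measure R).
Local Notation w := (@jacobi_weight R).
Local Notation cc01 := (`[(0%R : R), (1%R : R)]%classic).
Local Notation sym_itv := (`[(-1 : R), (1 : R)]%classic).
Implicit Types (f g : R * R -> R).

Variables (a c : R).
Hypotheses (a1 : -1 < a) (c1 : -1 < c).

Definition edges_L2 f : Prop :=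
  in_L2 sym_itv (sym_weight a c) (fun x => f (x, -1)) /\
  in_L2 sym_itv (sym_weight a c) (fun x => f (x, 1)).

Lemma measurable_part_edge (d1 d2 : bool) f : edges_L2 f ->
  measurable_fun cc01 (fun t => wedge_part d1 d2 f (t, 1)).
Proof.
move=> [[m1 _] [m2 _]].
have mS : measurable (sym_itv : set R) by exact: measurable_itv.
have ms : measurable_fun cc01 (@Num.sqrt R) by apply: measurable_funTS; exact: measurable_sqrt.
have sub1 : @Num.sqrt R @` cc01 `<=` sym_itv.
  move=> _ [t + <-]; rewrite /= !in_itv/= => /sqrt_itv01 /andP[? ?].
  by apply/andP; split; lra.
have sub2 : (fun t : R => - Num.sqrt t) @` cc01 `<=` sym_itv.
  move=> _ [t + <-]; rewrite /= !in_itv/= => /sqrt_itv01 /andP[? ?].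
  by apply/andP; split; lra.
have msN : measurable_fun cc01 (fun t : R => - Num.sqrt t).
  exact: (measurableT_comp (@oppr_measurable R setT) ms).
have M1 (v : R -> R) : measurable_fun sym_itv v -> measurable_fun cc01 (fun t => v (Num.sqrt t)).
  by move=> mv; exact: (measurable_comp mS sub1 mv ms).
have M2 (v : R -> R) : measurable_fun sym_itv v -> measurable_fun cc01 (fun t => v (- Num.sqrt t)).
  by move=> mv; exact: (measurable_comp mS sub2 mv msN).
rewrite /wedge_part /parity_quot /parity_part /= sqrtr1.
apply: measurable_funM.
  apply: measurable_funM; last exact: measurable_cst.
  case: (d1); last first.
    rewrite (_ : (fun x => _) = cst 1); first exact: measurable_cst.
    by apply/funext => t; rewrite expr0 invr1.
  have m : measurable_fun cc01 (fun t : R => Num.sqrt t `^ (-1)).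
    exact: (measurableT_comp (measurable_powR (-1)) ms).
  apply: eq_measurable_fun m => t _.
  by rewrite powR_inv1 ?sqrtr_ge0.
apply: measurable_funM; first exact: measurable_cst.
apply: measurable_funD; last first.
  by apply: measurable_funM; [exact: measurable_cst|exact: (M2 (fun x => f (x, -1)) m1)].
apply: measurable_funD; last first.
  by apply: measurable_funM; [exact: measurable_cst|exact: (M1 (fun x => f (x, -1)) m1)].
apply: measurable_funD; first exact: (M1 (fun x => f (x, 1)) m2).
by apply: measurable_funM; [exact: measurable_cst|exact: (M2 (fun x => f (x, 1)) m2)].
Qed.

(** The powers of x divided out of the odd parts are restored by the shift of
    the exponent. At t = 0 both sides vanish when d1 holds. *)
Lemma part_edge_density (d1 d2 : bool) f g t : 0 <= t ->
  wedge_part d1 d2 f (t, 1) * wedge_part d1 d2 g (t, 1) * w (a + d1%:R) c t =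
  parity_part d1 d2 f (Num.sqrt t, 1) * parity_part d1 d2 g (Num.sqrt t, 1) * w a c t.
Proof.
move=> t0; rewrite /wedge_part /parity_quot /psi /= sqrtr1.
case: d1 => /=; last by rewrite addr0 expr0 expr1n invr1 !mul1r.
rewrite jacobi_weightDl// expr1 expr1n.
have [s0|s0] := eqVneq (Num.sqrt t) 0.
  rewrite s0 (_ : parity_part true d2 f (0, 1) = 0); first by rewrite invr0 !(mulr0, mul0r).
  by rewrite /parity_part /= oppr0; case: (d2) => /=; ring.
have ts : t = Num.sqrt t ^+ 2 by rewrite sqr_sqrtr.
move: (w a c t) => W; rewrite [X in _ * (X * W)]ts.
by move: (Num.sqrt t) s0 => s s0; field.
Qed.

(** The sum over the four points (+-x, +-1) of f g is 4 times the sum over the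
    four parities of the products of parts: the parity characters are
    orthogonal. *)
Let fold_edges f g t : 0 <= t ->
  let u x := f (x, -1) * g (x, -1) + f (x, 1) * g (x, 1) in
  2^-1 * (u (Num.sqrt t) + u (- Num.sqrt t)) * w a c t =
  2 * (wedge_part false false f (t, 1) * wedge_part false false g (t, 1) * w (a + false%:R) c t)
  + 2 * (wedge_part false true f (t, 1) * wedge_part false true g (t, 1) * w (a + false%:R) c t)
  + 2 * (wedge_part true false f (t, 1) * wedge_part true false g (t, 1) * w (a + true%:R) c t)
  + 2 * (wedge_part true true f (t, 1) * wedge_part true true g (t, 1) * w (a + true%:R) c t).
Proof.
move=> t0 u; rewrite !part_edge_density// /u /parity_part /=.
by rewrite !expr0 !expr1 !expr2; field.
Qed.

Let integrable_edges f g : edges_L2 f -> edges_L2 g ->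
  mu.-integrable sym_itv (fun x =>
    ((f (x, -1) * g (x, -1) + f (x, 1) * g (x, 1)) * sym_weight a c x)%:E).
Proof.
move=> [f1 f2] [g1 g2].
have mS : measurable (sym_itv : set (measurableTypeR R)) by exact: measurable_itv.
have w0 x : sym_itv x -> 0 <= sym_weight a c x by move=> _; exact: sym_weight_ge0.
have mw : measurable_fun sym_itv (sym_weight a c) by exact: measurable_sym_weight.
have I1 := in_L2_mul mS mw w0 f1 g1.
have I2 := in_L2_mul mS mw w0 f2 g2.
have I := integrableD mS I1 I2.
by apply: (eq_integrable mS _ _ _ I) => x _; rewrite -EFinD -mulrDl.
Qed.

Let measurable_edges f g : edges_L2 f -> edges_L2 g ->
  measurable_fun sym_itv (fun x => f (x, -1) * g (x, -1) + f (x, 1) * g (x, 1)).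
Proof.
move=> [[f1 _] [f2 _]] [[g1 _] [g2 _]].
by apply: measurable_funD; apply: measurable_funM.
Qed.

(** The square of each part is one of the four nonnegative terms of fold_edges
    for f = g. *)
Lemma part_edge_L2 (d1 d2 : bool) f : edges_L2 f ->
  in_L2 cc01 (w (a + d1%:R) c) (fun t => wedge_part d1 d2 f (t, 1)).
Proof.
move=> Lf; have mp := measurable_part_edge d1 d2 Lf; split => //.
have mC : measurable (cc01 : set (measurableTypeR R)) by exact: measurable_itv.
have [I _] := sym_weight_fold (measurable_edges Lf Lf) (integrable_edges Lf Lf).
apply: (le_integrable mC _ _ I).
  apply/measurable_EFinP; apply: measurable_funM; last exact: measurable_jacobi_weightS.
  exact: measurable_funX.
move=> t; rewrite /= in_itv/= => /andP[t0 _]; rewrite lee_fin (fold_edges f f t0).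
have p0 e1 e2 : 0 <= wedge_part e1 e2 f (t, 1) * wedge_part e1 e2 f (t, 1) * w (a + e1%:R) c t.
  by apply: mulr_ge0 (jacobi_weight_ge0 _ _ _); rewrite -expr2 sqr_ge0.
rewrite expr2 (ger0_norm (p0 d1 d2)) ger0_norm; last first.
  by do 3 (apply: addr_ge0; last by apply: mulr_ge0); apply: mulr_ge0.
have := p0 false false; have := p0 false true.
have := p0 true false; have := p0 true true.
case: d1 {mp}; case: d2 => /=.
all: move: (_ * _ * w _ _ _) (_ * _ * w _ _ _) (_ * _ * w _ _ _) (_ * _ * w _ _ _) => x1 x2 x3 x4.
all: by lra.
Qed.

Lemma edge_parseval f g : edges_L2 f -> edges_L2 g ->
  let I d1 d2 := \int[mu]_(t in cc01)
    (wedge_part d1 d2 f (t, 1) * wedge_part d1 d2 g (t, 1) * w (a + d1%:R) c t) in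
  \int[mu]_(x in sym_itv)
    ((f (x, -1) * g (x, -1) + f (x, 1) * g (x, 1)) * sym_weight a c x) =
  2 * I false false + 2 * I false true + 2 * I true false + 2 * I true true.
Proof.
move=> Lf Lg I.
have mC : measurable (cc01 : set (measurableTypeR R)) by exact: measurable_itv.
have [_ ->] := sym_weight_fold (measurable_edges Lf Lg) (integrable_edges Lf Lg).
pose h d1 d2 t := wedge_part d1 d2 f (t, 1) * wedge_part d1 d2 g (t, 1) * w (a + d1%:R) c t.
have Ih d1 d2 : mu.-integrable cc01 (fun t => (h d1 d2 t)%:E).
  apply: in_L2_mul (part_edge_L2 d1 d2 Lf) (part_edge_L2 d1 d2 Lg) => //.
    exact: measurable_jacobi_weightS.
  by move=> t _; exact: jacobi_weight_ge0.
have I2 d1 d2 : mu.-integrable cc01 (EFin \o (fun t => 2 * h d1 d2 t)).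
  exact: (integrableZl mC 2 (Ih d1 d2)).
have EI d1 d2 : 2 * I d1 d2 = \int[mu]_(t in cc01) (2 * h d1 d2 t).
  by rewrite (RintegralZl 2 mC (Ih d1 d2)).
rewrite (EI false false) (EI false true) (EI true false) (EI true true).
have I3 := integrableD mC (I2 false false) (I2 false true).
have I4 := integrableD mC I3 (I2 true false).
rewrite -(RintegralD mC (I2 false false) (I2 false true)).
rewrite -(RintegralD mC I3 (I2 true false)) -(RintegralD mC I4 (I2 true true)).
apply: eq_Rintegral => t; rewrite inE/= in_itv/= => /andP[t0 _].
exact: fold_edges.
Qed.

End Edges.

(** * Partial sums on the square *)

Section Square.
Context {R : realType}.
Local Notation mu := (@lebesgue_measure R).
Local Notation w := (@jacobi_weight R).
Local Notation cc01 := (`[(0%R : R), (1%R : R)]%classic).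
Local Notation sym_itv := (`[(-1 : R), (1 : R)]%classic).
Implicit Types (f g : R * R -> R).

Lemma integrable_sym_weight_poly (a c : R) (p : {poly R}) : -1 < a -> -1 < c ->
  mu.-integrable sym_itv (fun x => (p.[x] * sym_weight a c x)%:E).
Proof.
move=> a1 c1.
have mS : measurable (sym_itv : set (measurableTypeR R)) by exact: measurable_itv.
have I0 : mu.-integrable sym_itv (fun x => (sym_weight a c x)%:E).
  apply/integrableP; split.
    by apply/measurable_EFinP; exact: measurable_sym_weight.
  have E1 : (\int[mu]_(x in sym_itv) `|(sym_weight a c x)%:E| =
      \int[mu]_(x in sym_itv) (cst (1 : R) x * sym_weight a c x)%:E)%E.
    by apply: eq_integral => x _; rewrite /= mul1r ger0_norm ?sym_weight_ge0.
  have E2 : (\int[mu]_(t in cc01) `|(w a c t)%:E| =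
      \int[mu]_(t in cc01) (2^-1 * (1 + 1) * w a c t)%:E)%E.
    apply: eq_integral => t _.
    by rewrite /= ger0_norm ?jacobi_weight_ge0// mulVf ?mul1r.
  rewrite E1 (ge0_sym_weight_fold a c (measurable_cst (1 : R)) (fun _ => ler01)) -E2.
  by have /integrableP[] := integrable_jacobi_weight a1 c1.
elim/poly_ind: p => [|p k IH].
  rewrite (_ : (fun _ => _) = cst 0%E); first exact: integrable0.
  by apply/funext => x; rewrite horner0 mul0r.
have Ik := integrableZl mS k I0.
have Ip : mu.-integrable sym_itv (fun x => (p.[x] * x * sym_weight a c x)%:E).
  apply: (le_integrable mS _ _ IH).
    apply/measurable_EFinP; apply: measurable_funM; last exact: measurable_sym_weight.
    by apply: measurable_funM => //; exact: measurable_horner.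
  move=> x; rewrite /= in_itv/= => x1; rewrite lee_fin !normrM.
  rewrite ler_wpM2r// ler_piMr// ler_norml//.
have I := integrableD mS Ip Ik.
apply: (eq_integrable mS _ _ _ I) => x _.
by rewrite -EFinM -EFinD hornerMXaddC mulrDl.
Qed.

Lemma poly_sym_L2 (a c : R) (g : R -> R) n : -1 < a -> -1 < c -> poly1_le n g ->
  in_L2 sym_itv (sym_weight a c) g.
Proof.
move=> a1 c1 /poly1_leP[p _ ->]; split; first exact: measurable_horner.
have := integrable_sym_weight_poly (p ^+ 2) a1 c1; congr (mu.-integrable _ _).
by apply/funext => x; rewrite horner_exp.
Qed.

(** Exchanging the coordinates turns the vertical edges into horizontal ones, so
    that the results on the latter serve for both. *)
Definition swap f : R * R -> R := fun z => f (z.2, z.1).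

Lemma wedge_part_swap (d1 d2 : bool) f (x y : R) :
  wedge_part d2 d1 (swap f) (y, x) = wedge_part d1 d2 f (x, y).
Proof.
rewrite /wedge_part /parity_quot /parity_part /swap /=.
by case: d1; case: d2 => /=; ring.
Qed.

Variables alpha beta gamma : R.
Hypotheses (alpha_gt : -1 < alpha) (beta_gt : -1 < beta) (gamma_gt : -1 < gamma).

Local Notation square_L2 := (square_L2 alpha beta gamma).
Local Notation square_ip := (square_ip alpha beta gamma).
Local Notation wedge_ip := (wedge_ip alpha beta gamma).
Local Notation wedge_L2 := (wedge_L2 alpha beta gamma).

Lemma square_edges f : square_L2 f ->
  edges_L2 alpha gamma f /\ edges_L2 beta gamma (swap f).
Proof. by move=> [? ? ? ?]. Qed.

Lemma poly2_square_L2 n : poly2_le n `<=` square_L2.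
Proof.
move=> g Vg; split.
- exact: poly_sym_L2 (poly2_edge1 (-1) Vg).
- exact: poly_sym_L2 (poly2_edge1 1 Vg).
- exact: poly_sym_L2 (poly2_edge2 (-1) Vg).
- exact: poly_sym_L2 (poly2_edge2 1 Vg).
Qed.

Lemma sym_L2B (a : R) (u v : R -> R) : in_L2 sym_itv (sym_weight a gamma) u ->
  in_L2 sym_itv (sym_weight a gamma) v -> in_L2 sym_itv (sym_weight a gamma) (u \- v).
Proof.
have mS : measurable (sym_itv : set R) by exact: measurable_itv.
have mw : measurable_fun sym_itv (sym_weight a gamma) by exact: measurable_sym_weight.
have w0 x : sym_itv x -> 0 <= sym_weight a gamma x by move=> _; exact: sym_weight_ge0.
exact: (lin_closedB (in_L2_semi_ip mS mw w0)).
Qed.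

Lemma square_L2B f g : square_L2 f -> square_L2 g -> square_L2 (f \- g).
Proof.
move=> [f1 f2 f3 f4] [g1 g2 g3 g4].
by split; [exact: sym_L2B f1 g1|exact: sym_L2B f2 g2|exact: sym_L2B f3 g3|exact: sym_L2B f4 g4].
Qed.

Lemma wedge_part_L2 (d1 d2 : bool) f : square_L2 f -> wedge_L2 d1 d2 (wedge_part d1 d2 f).
Proof.
move=> /square_edges[L1 L2]; split; first exact: part_edge_L2 L1.
have E : (fun y => wedge_part d1 d2 f (1, y)) =
    (fun y => wedge_part d2 d1 (swap f) (y, 1)).
  by apply/funext => y; rewrite wedge_part_swap.
by rewrite /preimage /= E; exact: part_edge_L2 L2.
Qed.

(** The factor wedge_sigma in the inner product of the wedge is what lets one
    constant serve for both of its edges. *)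
Definition parseval_const (d1 : bool) : R :=
  2 * jacobi_const alpha gamma / jacobi_const (alpha + d1%:R) gamma.

Lemma parseval_const_gt0 d1 : 0 < parseval_const d1.
Proof.
by rewrite divr_gt0 ?mulr_gt0 ?jacobi_const_gt0//; exact: shift_gt.
Qed.

(** The four parities are mutually orthogonal on the square, and t = x^2 turns
    the inner product of parts of the same parity into that of a wedge. *)
Lemma square_parseval f g : square_L2 f -> square_L2 g ->
  square_ip f g = \sum_(d1 : bool) \sum_(d2 : bool)
    parseval_const d1 * wedge_ip d1 d2 (wedge_part d1 d2 f) (wedge_part d1 d2 g).
Proof.
move=> /square_edges[f1 f2] /square_edges[g1 g2].
pose A d1 d2 := \int[mu]_(x in cc01) (wedge_part d1 d2 f (x, 1) *
  wedge_part d1 d2 g (x, 1) * w (alpha + d1%:R) gamma x).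
pose B d1 d2 := \int[mu]_(y in cc01) (wedge_part d1 d2 f (1, y) *
  wedge_part d1 d2 g (1, y) * w (beta + d2%:R) gamma y).
have BE d1 d2 : \int[mu]_(t in cc01) (wedge_part d2 d1 (swap f) (t, 1) *
    wedge_part d2 d1 (swap g) (t, 1) * w (beta + d2%:R) gamma t) = B d1 d2.
  by apply: eq_Rintegral => t _; rewrite !wedge_part_swap.
have -> : square_ip f g =
    jacobi_const alpha gamma * (2 * A false false + 2 * A false true
      + 2 * A true false + 2 * A true true) +
    jacobi_const beta gamma * (2 * B false false + 2 * B true false
      + 2 * B false true + 2 * B true true).
  rewrite /Defs.square_ip; congr (_ * _ + _ * _).
    exact: (edge_parseval alpha_gt f1 g1).
  have := edge_parseval beta_gt f2 g2; rewrite /= !BE; exact.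
have KE d1 d2 : parseval_const d1 *
    wedge_ip d1 d2 (wedge_part d1 d2 f) (wedge_part d1 d2 g) =
    2 * jacobi_const alpha gamma * A d1 d2 + 2 * jacobi_const beta gamma * B d1 d2.
  rewrite /Defs.wedge_ip -/(A d1 d2) -/(B d1 d2) /parseval_const /wedge_sigma.
  have := jacobi_const_gt0 alpha_gt gamma_gt.
  have := jacobi_const_gt0 (shift_gt d1 alpha_gt) gamma_gt.
  have := jacobi_const_gt0 (shift_gt d2 beta_gt) gamma_gt.
  move: (jacobi_const _ _) (jacobi_const _ _) (jacobi_const alpha _) => p q r p0 q0 r0.
  by field; rewrite !gt_eqF.
rewrite (eq_bigr _ (fun d1 _ => eq_bigr _ (fun d2 _ => KE d1 d2))) !big_bool.
move: A B (jacobi_const _ _) (jacobi_const _ _) {BE KE} => A B p q.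
move: (A true true) (A true false) (A false true) (A false false) => a1 a2 a3 a4.
move: (B true true) (B true false) (B false true) (B false false) => b1 b2 b3 b4.
by rewrite /=; clear; ring.
Qed.

(** At t = 0 the weight of exponent alpha + 1 vanishes, since alpha + 1 <> 0;
    agreement off 0 therefore suffices on the edge along which a part is odd. *)
Lemma eq_wedge_ip (d1 d2 : bool) f g f' g' :
  (forall t, 0 <= t <= 1 -> (d1 -> t != 0) -> f (t, 1) = f' (t, 1) /\ g (t, 1) = g' (t, 1)) ->
  (forall t, 0 <= t <= 1 -> (d2 -> t != 0) -> f (1, t) = f' (1, t) /\ g (1, t) = g' (1, t)) ->
  wedge_ip d1 d2 f g = wedge_ip d1 d2 f' g'.
Proof.
have w0 (a : R) (d : bool) t : -1 < a -> (t == 0) && d -> w (a + d%:R) gamma t = 0.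
  by move=> a1 /andP[/eqP -> ->]; rewrite jacobi_weightDl// mul0r.
move=> E1 E2; rewrite /Defs.wedge_ip; congr (_ * _ + _ * _).
all: apply: eq_Rintegral => t; rewrite inE/= in_itv/= => t01.
  have [td|td] := boolP ((t == 0) && d1); first by rewrite w0 ?mulr0.
  have [|-> ->//] := E1 t t01; by move: td; rewrite negb_and => /orP[//|/negP].
have [td|td] := boolP ((t == 0) && d2); first by rewrite w0 ?mulr0.
have [|-> ->//] := E2 t t01; by move: td; rewrite negb_and => /orP[//|/negP].
Qed.

Definition orth_parts n f (h : bool -> bool -> R * R -> R) :=
  forall d1 d2 q, poly2_le (part_degree n d1 d2) q ->
    wedge_ip d1 d2 (wedge_part d1 d2 f \- h d1 d2) q = 0.

Lemma square_ip_unfold n f h q : (2 <= n)%N -> square_L2 f ->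
  (forall d1 d2, poly2_le (part_degree n d1 d2) (h d1 d2)) ->
  (forall d1 d2, poly2_le (part_degree n d1 d2) (q d1 d2)) ->
  square_ip (f \- unfold_parts h) (unfold_parts q) = \sum_(d1 : bool) \sum_(d2 : bool)
    parseval_const d1 * wedge_ip d1 d2 (wedge_part d1 d2 f \- h d1 d2) (q d1 d2).
Proof.
move=> n2 Lf Vh Vq.
have Lh : square_L2 (unfold_parts h).
  exact: poly2_square_L2 (unfold_parts_poly n2 Vh).
have Lq : square_L2 (unfold_parts q).
  exact: poly2_square_L2 (unfold_parts_poly n2 Vq).
rewrite (square_parseval (square_L2B Lf Lh) Lq).
apply: eq_bigr => d1 _; apply: eq_bigr => d2 _; congr (_ * _).
by apply: eq_wedge_ip => t /andP[t0 t1] td;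
  rewrite wedge_partB /= !wedge_part_unfold ?oner_neq0.
Qed.

Lemma square_ip_err n f h : (2 <= n)%N -> square_L2 f ->
  (forall d1 d2, poly2_le (part_degree n d1 d2) (h d1 d2)) ->
  square_ip (unfold_parts h \- f) (unfold_parts h \- f) =
  \sum_(d1 : bool) \sum_(d2 : bool) parseval_const d1 *
    wedge_ip d1 d2 (h d1 d2 \- wedge_part d1 d2 f) (h d1 d2 \- wedge_part d1 d2 f).
Proof.
move=> n2 Lf Vh.
have Lh : square_L2 (unfold_parts h).
  exact: poly2_square_L2 (unfold_parts_poly n2 Vh).
have L := square_L2B Lh Lf; rewrite (square_parseval L L).
apply: eq_bigr => d1 _; apply: eq_bigr => d2 _; congr (_ * _).
by apply: eq_wedge_ip => t /andP[t0 t1] td;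
  rewrite wedge_partB /= !wedge_part_unfold ?oner_neq0.
Qed.

(** A polynomial of degree n on the square is made of four independent
    polynomials of degrees part_degree n d1 d2, and square_parseval tests them
    separately. *)
Lemma orth_parts_square n f h : (2 <= n)%N -> square_L2 f ->
  (forall d1 d2, poly2_le (part_degree n d1 d2) (h d1 d2)) ->
  (forall q, poly2_le n q -> square_ip (f \- unfold_parts h) q = 0) <->
  orth_parts n f h.
Proof.
move=> n2 Lf Vh; split=> [H d1 d2 q Vq|H q /(poly_unfold_parts n2)[q' Vq' ->]].
  pose qs e1 e2 := if (e1 == d1) && (e2 == d2) then q else fun=> 0.
  have Vqs e1 e2 : poly2_le (part_degree n e1 e2) (qs e1 e2).
    rewrite /qs; case: ifP => [/andP[/eqP -> /eqP ->]//|_].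
    exact: (poly2_lin_closed _).1.
  have ip0 e1 e2 u : wedge_ip e1 e2 u (fun=> 0) = 0.
    rewrite /Defs.wedge_ip.
    by do 2 (rewrite [Rintegral _ _ _](_ : _ = 0); last
      by rewrite /Rintegral integral0_eq// => x _; rewrite mulr0 mul0r);
      rewrite !mulr0 addr0.
  have := H _ (unfold_parts_poly n2 Vqs); rewrite (square_ip_unfold n2 Lf Vh Vqs).
  rewrite (bigD1 d1)//= (bigD1 d2)//= {1}/qs !eqxx /=.
  rewrite big1 => [|e2 /negPf ne]; last by rewrite /qs ne andbF ip0 mulr0.
  rewrite big1 => [|e1 /negPf ne]; last first.
    by rewrite big1 // => e2 _; rewrite /qs ne ip0 mulr0.
  move/eqP; rewrite !addr0 mulf_eq0 (gt_eqF (parseval_const_gt0 d1)).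
  by move/eqP.
rewrite (square_ip_unfold n2 Lf Vh Vq') big1// => d1 _; rewrite big1// => d2 _.
by rewrite H ?mulr0.
Qed.

Lemma square_projE n f : (2 <= n)%N -> square_L2 f -> exists2 h,
  (forall d1 d2, poly2_le (part_degree n d1 d2) (h d1 d2)) &
  square_proj alpha beta gamma n f = unfold_parts h /\
  forall (d1 d2 : bool) x,
    wedge_proj alpha beta gamma d1 d2 (part_degree n d1 d2) (wedge_part d1 d2 f) (x, 1)
      = h d1 d2 (x, 1) /\
    wedge_proj alpha beta gamma d1 d2 (part_degree n d1 d2) (wedge_part d1 d2 f) (1, x)
      = h d1 d2 (1, x).
Proof.
move=> n2 Lf; have LW d1 d2 := wedge_part_L2 d1 d2 Lf.
have WP d1 d2 := wedge_projP alpha_gt beta_gt gamma_gt (part_degree n d1 d2) (LW d1 d2).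
pose S d1 d2 := wedge_proj alpha beta gamma d1 d2 (part_degree n d1 d2) (wedge_part d1 d2 f).
have VS d1 d2 : poly2_le (part_degree n d1 d2) (S d1 d2) by case: (WP d1 d2).
have SP : projectable square_ip (poly2_le n) f.
  exists (unfold_parts S); first exact: unfold_parts_poly.
  by apply/(orth_parts_square n2 Lf VS) => d1 d2 q; case: (WP d1 d2) => _; exact.
have [/(poly_unfold_parts n2)[h Vh hE] gP] := orth_projP SP.
exists h => //; split; first exact: hE.
rewrite hE in gP; move/(orth_parts_square n2 Lf Vh): gP => gP d1 d2 x.
exact: (wedge_proj_unique alpha_gt beta_gt gamma_gt (LW d1 d2) (Vh d1 d2) (gP d1 d2)).
Qed.

(** Orthogonality on the square amounts to orthogonality of each part on its
    wedge, where the projection is unique; and (x^2, y^2) is on the wedge. *)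
Lemma square_proj_parts n f x y : (2 <= n)%N -> square_L2 f -> square_bd (x, y) ->
  let S d1 d2 := wedge_proj alpha beta gamma d1 d2 (part_degree n d1 d2)
    (wedge_part d1 d2 f) (x ^+ 2, y ^+ 2) in
  square_proj alpha beta gamma n f (x, y) =
  S false false + y * S false true + x * S true false + x * y * S true true.
Proof.
move=> n2 Lf xy S; have [h Vh [-> hS]] := square_projE n2 Lf.
suff E d1 d2 : S d1 d2 = h d1 d2 (x ^+ 2, y ^+ 2) by rewrite !E.
have [y1|x1] : y ^+ 2 = 1 \/ x ^+ 2 = 1.
  move: xy; rewrite /square_bd /= -[y ^+ 2]real_normK ?num_real// -[x ^+ 2]real_normK ?num_real//.
  by have [_ ->|_ ->] := leP `|x| `|y|; rewrite expr1n; [left|right].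
- by rewrite /S y1; case: (hS d1 d2 (x ^+ 2)).
- by rewrite /S x1; case: (hS d1 d2 (y ^+ 2)).
Qed.

Lemma square_error_le n f : (2 <= n)%N -> square_L2 f ->
  square_norm alpha beta gamma (square_proj alpha beta gamma n f \- f) <=
  \sum_(d1 : bool) \sum_(d2 : bool) Num.sqrt (parseval_const d1) *
    wedge_norm alpha beta gamma d1 d2
      (wedge_proj alpha beta gamma d1 d2 (part_degree n d1 d2) (wedge_part d1 d2 f)
       \- wedge_part d1 d2 f).
Proof.
move=> n2 Lf; have [h Vh [-> hS]] := square_projE n2 Lf.
rewrite /square_norm (square_ip_err n2 Lf Vh).
have E d1 d2 : Num.sqrt (parseval_const d1) * wedge_norm alpha beta gamma d1 d2
      (wedge_proj alpha beta gamma d1 d2 (part_degree n d1 d2) (wedge_part d1 d2 f)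
       \- wedge_part d1 d2 f) = Num.sqrt (parseval_const d1 *
    wedge_ip d1 d2 (h d1 d2 \- wedge_part d1 d2 f) (h d1 d2 \- wedge_part d1 d2 f)).
  rewrite [RHS]sqrtrM ?(ltW (parseval_const_gt0 d1))//; congr (_ * _).
  rewrite /wedge_norm; congr Num.sqrt.
  by apply: eq_wedge_ip => t _ _ /=; case: (hS d1 d2 t) => E1 E2; rewrite ?E1 ?E2.
have P0 d1 d2 : 0 <= parseval_const d1 *
    wedge_ip d1 d2 (h d1 d2 \- wedge_part d1 d2 f) (h d1 d2 \- wedge_part d1 d2 f).
  apply: mulr_ge0 (ltW (parseval_const_gt0 d1)) _.
  have sip := wedge_semi_ip alpha_gt beta_gt gamma_gt d1 d2.
  apply: (sip_ge0 sip); apply: (lin_closedB sip); last exact: wedge_part_L2.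
  exact: (poly2_sub_wedge_L2 alpha_gt beta_gt gamma_gt d1 d2 (Vh d1 d2)).
rewrite (eq_bigr _ (fun d1 _ => eq_bigr _ (fun d2 _ => E d1 d2))).
apply: (le_trans (sqrtr_sum_le _)) => [d1|]; first by apply: sumr_ge0 => d2 _.
by apply: ler_sum => d1 _; exact: sqrtr_sum_le.
Qed.

End Square.

Theorem theorem3p3 (R : realType) (alpha beta gamma : R)
    (alpha_gt : -1 < alpha) (beta_gt : -1 < beta) (gamma_gt : -1 < gamma) :
  (forall f : R * R -> R, square_L2 alpha beta gamma f ->
   forall m : nat, (1 <= m)%N ->
   forall x y : R, square_bd (x, y) ->
     let S d1 d2 k := wedge_proj alpha beta gamma d1 d2 k
                        (wedge_part d1 d2 f) (x ^+ 2, y ^+ 2) in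
     square_proj alpha beta gamma (2 * m) f (x, y) =
       S false false m + y * S false true m.-1
       + x * S true false m.-1 + x * y * S true true m.-1
     /\
     square_proj alpha beta gamma (2 * m + 1) f (x, y) =
       S false false m + y * S false true m
       + x * S true false m + x * y * S true true m.-1)
  /\
  exists2 c : R, 0 < c &
    forall f : R * R -> R, square_L2 alpha beta gamma f ->
    forall n : nat, (2 <= n)%N ->
      let k (d1 d2 : bool) := ((n - d1 - d2) %/ 2)%N in
      let err d1 d2 := wedge_norm alpha beta gamma d1 d2
        (wedge_proj alpha beta gamma d1 d2 (k d1 d2) (wedge_part d1 d2 f)
         \- wedge_part d1 d2 f) in
      square_norm alpha beta gamma (square_proj alpha beta gamma n f \- f)
        <= c * \sum_(d1 : bool) \sum_(d2 : bool) err d1 d2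
      /\
      forall d1 d2 : bool,
        let a := alpha + d1%:R in
        let b := beta + d2%:R in
        let H := wedge_part d1 d2 f in
        let H1 x := H (x, 1) in
        let H2 x := H (1, x) in
        let g1 := diff_quot (H (1, 1)) H1 in
        let g2 := diff_quot (H (1, 1)) H2 in
        let j := k d1 d2 in
        err d1 d2 <=
          c * (jacobi_norm a gamma (H1 \- jacobi_proj a gamma j H1)
               + jacobi_norm b gamma (H2 \- jacobi_proj b gamma j H2)
               + jacobi_norm a (gamma + 2)
                   (g1 \- jacobi_proj a (gamma + 2) j g1)
               + jacobi_norm b (gamma + 2)
                   (g2 \- jacobi_proj b (gamma + 2) j g2)).
Proof.
split=> [f Lf [//|m] _ x y xy S|].
  split.
    have := square_proj_parts alpha_gt beta_gt gamma_gt (_ : 2 <= 2 * m.+1)%N Lf xy.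
    have d00 : part_degree (2 * m.+1) false false = m.+1 by rewrite /part_degree; lia.
    have d01 : part_degree (2 * m.+1) false true = m by rewrite /part_degree; lia.
    have d10 : part_degree (2 * m.+1) true false = m by rewrite /part_degree; lia.
    have d11 : part_degree (2 * m.+1) true true = m by rewrite /part_degree; lia.
    by rewrite /= d00 d01 d10 d11; apply; lia.
  have := square_proj_parts alpha_gt beta_gt gamma_gt (_ : 2 <= 2 * m.+1 + 1)%N Lf xy.
  have d00 : part_degree (2 * m.+1 + 1) false false = m.+1 by rewrite /part_degree; lia.
  have d01 : part_degree (2 * m.+1 + 1) false true = m.+1 by rewrite /part_degree; lia.
  have d10 : part_degree (2 * m.+1 + 1) true false = m.+1 by rewrite /part_degree; lia.
  have d11 : part_degree (2 * m.+1 + 1) true true = m by rewrite /part_degree; lia.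
  by rewrite /= d00 d01 d10 d11; apply; lia.
have [C CP] := choice (fun d : bool * bool => wedge_error_le alpha_gt beta_gt gamma_gt d.1 d.2).
pose K d1 := Num.sqrt (parseval_const alpha gamma d1).
have [c c0 [cK cC]] : exists2 c, 0 < c & (forall d1, K d1 <= c) /\ (forall d, C d <= c).
  have K0 d : 0 <= K d by exact: sqrtr_ge0.
  have C0 d : 0 <= C d by case: (CP d) => /ltW.
  exists (1 + \sum_d K d + \sum_d C d); first by rewrite ltr_wpDr ?sumr_ge0// ltr_wpDr ?sumr_ge0.
  have SK d : K d <= \sum_d K d by rewrite (bigD1 d)//= lerDl sumr_ge0.
  have SC d : C d <= \sum_d C d by rewrite (bigD1 d)//= lerDl sumr_ge0.
  have SK0 : 0 <= \sum_d K d by exact: sumr_ge0.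
  have SC0 : 0 <= \sum_d C d by exact: sumr_ge0.
  move: (bigop _ _ _) (bigop _ _ _) SK SC SK0 SC0 => s t SK SC s0 t0.
  by split=> d; [apply: (le_trans (SK d))|apply: (le_trans (SC d))]; clear -s0 t0; lra.
exists c => // f Lf n n2 k err.
have err0 d1 d2 : 0 <= err d1 d2 by exact: sqrtr_ge0.
split.
  apply: (le_trans (square_error_le alpha_gt beta_gt gamma_gt n2 Lf)).
  rewrite mulr_sumr; apply: ler_sum => d1 _; rewrite mulr_sumr; apply: ler_sum => d2 _.
  exact: ler_wpM2r (err0 d1 d2) _ _ (cK d1).
move=> d1 d2; cbv zeta.
have WH := wedge_part_L2 alpha_gt beta_gt d1 d2 Lf.
apply: (le_trans ((CP (d1, d2)).2 _ (k d1 d2) WH)); rewrite /corner_error /=.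
set H := wedge_part d1 d2 f; set a := alpha + _; set b := beta + _.
set e1 := jacobi_norm a gamma _; set e2 := jacobi_norm b gamma _.
set e3 := jacobi_norm a (gamma + 2) _; set e4 := jacobi_norm b (gamma + 2) _.
have : 0 <= e1 + e2 + e3 + e4 by rewrite !addr_ge0// jacobi_norm_ge0.
move: e1 e2 e3 e4 => e1 e2 e3 e4 e0.
have -> : e1 + e3 + (e2 + e4) = e1 + e2 + e3 + e4 by rewrite addrACA !addrA.
exact: ler_wpM2r e0 _ _ (cC (d1, d2)).
Qed.
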